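(* Let $\mathcal{O}$ be a generalised octagon fully embedded in a metasymplectic space $\mathcal{M}$ such that the embedding is pseudo-isometric and strongly polarised. Then the embedding of $\mathcal{O}$ in $\mathcal{M}$ is symmetric and ovoidal if, and only if, it is dense.
   Context: Geometries. A geometry of rank $n$ is a tuple $(V_1,\dots,V_n,C)$ with $V_1,\dots,V_n$ disjoint non-empty sets and $C\subseteq V_1\times\dots\times V_n$ (chambers). Elements of distinct $V_i,V_j$ are incident if they lie in a common chamber. Elements of $V_1$ are points, elements of $V_2$ lines; two points are collinear if some line is incident with both. The geometry is connected if its incidence graph is connected. Its dual is $(V_n,\dots,V_1,C^D)$, chambers being read in reverse order. For $v\in V_i$, the $v$-shadow-geometry (resp. $v$-residue-geometry) consists of the elements of types $1,\dots,i-1$ (resp. $i+1,\dots,n$) incident with $v$, with chambers the corresponding truncations of the chambers containing $v$. Generalised octagon: a rank $2$ geometry of points and lines whose incidence graph has diameter $8$ and girth $16$, and such that for some cardinals $s,t\ge 2$ every point is incident with $t+1$ lines and every line with $s+1$ points. Polar space of rank $3$: a rank $3$ geometry of points, lines and planes (in the usual sense, the lines and planes being the singular subspaces of projective dimension $1$ and $2$, planes being the maximal singular subspaces) such that every line has at least $3$ points, no point is collinear with every other point, and for every point $x$ and line $L$ not incident with $x$, either exactly one or all points of $L$ are collinear to $x$. A dual polar space of rank $3$ is the dual of a polar space of rank $3$. Metasymplectic space: a connected rank $4$ geometry $\mathcal{M}$ of points, lines, planes and symplecta (symps), with at least two symps, such that (MS1) for each symp $\Sigma$ the $\Sigma$-shadow-geometry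 is a polar space of rank $3$; (MS2) for each point $x$ the $x$-residue-geometry is a dual polar space of rank $3$; (MS3) the intersection of two distinct symps is empty, a point, a line or a plane. Lines, planes and symps are identified with their sets of points. The dual $\overline{\mathcal{M}}$ of $\mathcal{M}$ is again a metasymplectic space. Two distinct points $x,y$ of $\mathcal{M}$ satisfy exactly one of: collinear; symplectic (not collinear, and there is a unique symp containing both); special (not collinear, and there is a unique point collinear to both); opposite (no point is collinear to both). Two distinct symps satisfy exactly one of: adjacent (they intersect in a plane); symplectic (they intersect in a unique point); special (there is a unique symp adjacent to both); opposite (no symp is adjacent to both). These words refer to $\mathcal{M}$. For a symp $\Sigma$ and a point $x\in\Sigma$, the $\{x,\Sigma\}$-GQ is the generalised quadrangle whose points are the lines of $\Sigma$ through $x$ and whose lines are the planes of $\Sigma$ through $x$. An ovoid of a generalised quadrangle is a set of points such that every line is incident with exactly one of them. A generalised octagon $\mathcal{O}$ is fully embedded in $\mathcal{M}$ if its points and lines are points and lines of $\mathcal{M}$, incidence in $\mathcal{O}$ is that of $\mathcal{M}$, and for every line of $\mathcal{O}$ all points of $\mathcal{M}$ on it are points of $\mathcal{O}$. The distance of two points of $\mathcal{O}$ is their distance in the collinearity graph of $\mathcal{O}$. The (full) embedding is: - pseudo-isometric if two (distinct) points of $\mathcal{O}$ are at distance $1$, $2$, $3$, $4$ if, and only if, they are respectively collinear, symplectic, special, opposite; - strongly polarised if through every point $x$ of $\mathcal{O}$ there exists a unique symp $x^\theta$ of $\mathcal{M}$ such that all points collinear to $x$ in $\mathcal{O}$ are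 contained in $x^\theta$, and two points $x,y$ of $\mathcal{O}$ are collinear, symplectic, special or opposite, respectively, if, and only if, the symps $x^\theta$ and $y^\theta$ are adjacent, symplectic, special or opposite, respectively; - symmetric if there is a map $\theta$ from the points and lines of $\mathcal{O}$ to the symps and planes of $\mathcal{M}$ such that: for a point $x$ of $\mathcal{O}$, $x^\theta$ is a symp containing all points of $\mathcal{O}$ at distance $1$ from $x$; for a line $L$ of $\mathcal{O}$, $L^\theta$ is a plane and $x^\theta$ contains $L^\theta$ for every point $x$ on $L$; the symps in the image of $\theta$ (as points) and the planes in the image of $\theta$ (as lines) form a generalised octagon $\overline{\mathcal{O}}$ fully embedded in $\overline{\mathcal{M}}$; - ovoidal if it is symmetric and, for every point $x$ of $\mathcal{O}$, the lines of $\mathcal{O}$ in the $\{x,x^\theta\}$-GQ form an ovoid of that generalised quadrangle and the planes of $\overline{\mathcal{O}}$ in the $\{x,x^\theta\}$-GQ form an ovoid of the dual generalised quadrangle; - dense if every symp of $\mathcal{M}$ contains at least one point of $\mathcal{O}$. *)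

(* Defs.v *)
From mathcomp Require Import all_boot.
From mathcomp Require Import classical_sets functions cardinality.

Set Implicit Arguments.
Unset Strict Implicit.
Unset Printing Implicit Defensive.

Local Open Scope classical_set_scope.
Local Open Scope card_scope.

Section Graphs.
Variables (T : Type) (E : T -> T -> Prop).

Fixpoint walk (k : nat) (u v : T) : Prop :=
  if k is k'.+1 then exists2 w, E u w & walk k' w v else u = v.

Definition graph_dist (u v : T) (d : nat) : Prop :=
  walk d u v /\ forall k, (k < d)%N -> ~ walk k u v.

Definition graph_connected (V : set T) : Prop :=
  forall u v, V u -> V v -> exists k, walk k u v.

Definition graph_diameter (V : set T) (d : nat) : Prop :=
  (forall u v, V u -> V v -> exists2 k, (k <= d)%N & walk k u v) /\
  (exists u v, [/\ V u, V v & graph_dist u v d]).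

Definition graph_circuit (k : nat) : Prop :=
  (3 <= k)%N /\
  exists2 c : 'I_k -> T, injective c & forall i, E (c i) (c (ordS i)).

Definition graph_girth (g : nat) : Prop :=
  graph_circuit g /\ forall k, graph_circuit k -> (g <= k)%N.

End Graphs.

(* The types are indexed by 0, ..., n-1.  All elements live in an ambient type
   [T], so that sub-, shadow- and residue-geometries have elements in the same
   type.  The axioms are in [is_geometry]. *)
Record geometry (T : Type) (n : nat) := Geometry {
  element : 'I_n -> set T;
  chamber : set ('I_n -> T) }.

Section Geometries.
Variable T : Type.

Definition is_geometry n (G : geometry T n) : Prop :=
  [/\ forall i, element G i !=set0,
      trivIset setT (element G)
    & forall c, chamber G c -> forall i, element G i (c i)].

Definition incident n (G : geometry T n) (u v : T) : Prop :=
  exists c i j, [/\ chamber G c, i != j, c i = u & c j = v].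

Definition elements n (G : geometry T n) : set T :=
  [set u | exists i, element G i u].

Definition connected_geometry n (G : geometry T n) : Prop :=
  graph_connected (incident G) (elements G).

Definition dual_geometry n (G : geometry T n) : geometry T n :=
  Geometry (fun i => element G (rev_ord i))
           [set c | chamber G (fun i => c (rev_ord i))].

Definition shadow_geometry n (G : geometry T n) (i : 'I_n) (v : T) :
    geometry T i :=
  let w (j : 'I_i) : 'I_n := widen_ord (ltnW (ltn_ord i)) j in
  Geometry (fun j => [set u | element G (w j) u /\ incident G u v])
           [set d | exists c, [/\ chamber G c, c i = v
                                & forall j, d j = c (w j)]].

Definition residue_geometry n (G : geometry T n) (i : 'I_n) (v : T) :
    geometry T (n - i.+1) :=
  let w (j : 'I_(n - i.+1)) : 'I_n :=
    cast_ord (subnKC (ltn_ord i)) (rshift i.+1 j) in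
  Geometry (fun j => [set u | element G (w j) u /\ incident G u v])
           [set d | exists c, [/\ chamber G c, c i = v
                                & forall j, d j = c (w j)]].

Definition points n (G : geometry T n.+1) : set T :=
  element G (@Ordinal n.+1 0 isT).
Definition lines n (G : geometry T n.+2) : set T :=
  element G (@Ordinal n.+2 1 isT).
Definition planes n (G : geometry T n.+3) : set T :=
  element G (@Ordinal n.+3 2 isT).
Definition symps n (G : geometry T n.+4) : set T :=
  element G (@Ordinal n.+4 3 isT).

(* The point set of an element; that of a point [p] is [set p]. *)
Definition pts n (G : geometry T n.+1) (u : T) : set T :=
  [set p | points G p /\ (p = u \/ incident G p u)].

(* The convention that elements are identified with their sets of points:
   an element is determined by its point set, incidence is containment of
   point sets, and the chambers are the maximal flags. *)
Definition identified_with_pts n (G : geometry T n.+1) : Prop :=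
  [/\ forall i j u v, element G i u -> element G j v ->
        pts G u = pts G v -> u = v,
      forall (i j : 'I_n.+1) u v, (i < j)%N -> element G i u -> element G j v ->
        (incident G u v <-> pts G u `<=` pts G v)
    & forall c, chamber G c <->
        (forall i, element G i (c i)) /\
        (forall i j : 'I_n.+1, (i < j)%N -> incident G (c i) (c j))].

(* Reflexive on points that lie on a line. *)
Definition collinear n (G : geometry T n.+2) (x y : T) : Prop :=
  exists2 L, lines G L & incident G x L /\ incident G y L.

(* The rank 2 geometry with point set P and line set L, and the incidence
   of G. *)
Definition subgeometry2 n (G : geometry T n) (P L : set T) : geometry T 2 :=
  Geometry (fun i : 'I_2 => if i == ord0 then P else L)
           [set c | [/\ P (c ord0), L (c ord_max)
                      & incident G (c ord0) (c ord_max)]].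

(* The cardinals s and t are represented by types; s + 1 is [option s]. *)
Definition generalised_octagon (G : geometry T 2) : Prop :=
  [/\ is_geometry G,
      graph_diameter (incident G) (elements G) 8,
      graph_girth (incident G) 16
    & exists s t : Type,
      [/\ `I_2 #<= [set: s], `I_2 #<= [set: t],
          forall p, points G p ->
            [set L | lines G L /\ incident G p L] #= [set: option t]
        & forall L, lines G L ->
            [set p | points G p /\ incident G p L] #= [set: option s]]].

Definition subspace n (G : geometry T n.+2) (X : set T) : Prop :=
  X `<=` points G /\
  forall L x y, lines G L -> X x -> X y -> x <> y ->
    incident G x L -> incident G y L -> pts G L `<=` X.

Definition singular_subspace n (G : geometry T n.+2) (X : set T) : Prop :=
  subspace G X /\ forall x y, X x -> X y -> x <> y -> collinear G x y.

Definition generated_by n (G : geometry T n.+2) (k : nat) (X : set T) : Prop :=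
  exists2 f : 'I_k -> T, (forall i, points G (f i))
                       & X = smallest (subspace G) (range f).

(* Projective dimension d: d + 1 is the least size of a generating set. *)
Definition proj_dim n (G : geometry T n.+2) (X : set T) (d : nat) : Prop :=
  generated_by G d.+1 X /\ forall k, (k <= d)%N -> ~ generated_by G k X.

Definition maximal_singular n (G : geometry T n.+2) (X : set T) : Prop :=
  singular_subspace G X /\
  forall Y, singular_subspace G Y -> X `<=` Y -> Y = X.

Record polar_space3 (G : geometry T 3) : Prop := PolarSpace3 {
  polar_geometry : is_geometry G;
  polar_identified : identified_with_pts G;
  polar_lines : forall X, (exists2 L, lines G L & pts G L = X) <->
    singular_subspace G X /\ proj_dim G X 1;
  polar_planes : forall X, (exists2 p, planes G p & pts G p = X) <->
    singular_subspace G X /\ proj_dim G X 2;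
  polar_planes_max : forall X, (exists2 p, planes G p & pts G p = X) <->
    maximal_singular G X;
  polar_thick : forall L, lines G L -> `I_3 #<= pts G L;
  polar_nondegenerate : forall x, points G x ->
    exists y, [/\ points G y, y <> x & ~ collinear G x y];
  polar_one_or_all : forall x L, points G x -> lines G L -> ~ incident G x L ->
    (exists! y, pts G L y /\ collinear G x y) \/
    (forall y, pts G L y -> collinear G x y) }.

Definition dual_polar_space3 (G : geometry T 3) : Prop :=
  polar_space3 (dual_geometry G).

Record metasymplectic_space (M : geometry T 4) : Prop := MetasymplecticSpace {
  ms_geometry : is_geometry M;
  ms_identified : identified_with_pts M;
  ms_connected : connected_geometry M;
  ms_two_symps : exists S S', [/\ symps M S, symps M S' & S <> S'];
  ms_shadow : forall S, symps M S ->
    polar_space3 (shadow_geometry M (@Ordinal 4 3 isT) S);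
  ms_residue : forall x, points M x ->
    dual_polar_space3 (residue_geometry M (@Ordinal 4 0 isT) x);
  ms_intersection : forall S S', symps M S -> symps M S' -> S <> S' ->
    [\/ pts M S `&` pts M S' = set0,
        exists2 p, points M p & pts M S `&` pts M S' = [set p],
        exists2 L, lines M L & pts M S `&` pts M S' = pts M L
      | exists2 p, planes M p & pts M S `&` pts M S' = pts M p] }.

Section Relations.
Variable M : geometry T 4.

(* The relations on points below are meant for distinct x and y. *)
Definition symplectic_points (x y : T) : Prop :=
  ~ collinear M x y /\ exists! S, [/\ symps M S, pts M S x & pts M S y].

Definition special_points (x y : T) : Prop :=
  ~ collinear M x y /\
  exists! z, [/\ points M z, collinear M z x & collinear M z y].

Definition opposite_points (x y : T) : Prop :=
  ~ exists z, [/\ points M z, collinear M z x & collinear M z y].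

Definition adjacent_symps (S S' : T) : Prop :=
  S <> S' /\ exists2 p, planes M p & pts M S `&` pts M S' = pts M p.

Definition symplectic_symps (S S' : T) : Prop :=
  S <> S' /\ exists2 p, points M p & pts M S `&` pts M S' = [set p].

Definition special_symps (S S' : T) : Prop :=
  S <> S' /\
  exists! R, [/\ symps M R, adjacent_symps R S & adjacent_symps R S'].

Definition opposite_symps (S S' : T) : Prop :=
  S <> S' /\
  ~ exists R, [/\ symps M R, adjacent_symps R S & adjacent_symps R S'].

(* The generalised quadrangle of the lines and planes of S through x. *)
Definition symp_gq (x S : T) : geometry T 2 :=
  subgeometry2 M [set L | [/\ lines M L, incident M x L & incident M L S]]
                 [set p | [/\ planes M p, incident M x p & incident M p S]].

End Relations.

Definition ovoid (Q : geometry T 2) (A : set T) : Prop :=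
  A `<=` points Q /\
  forall l, lines Q l -> exists! p, A p /\ incident Q p l.

Definition fully_embedded (O : geometry T 2) (M : geometry T 4) : Prop :=
  [/\ points O `<=` points M,
      lines O `<=` lines M,
      forall x L, points O x -> lines O L -> (incident O x L <-> incident M x L)
    & forall L, lines O L -> pts M L `<=` points O].

Section Embeddings.
Variables (O : geometry T 2) (M : geometry T 4).

Definition collinearity_graph (x y : T) : Prop :=
  [/\ points O x, points O y, x <> y & collinear O x y].

Definition octagon_dist (x y : T) (d : nat) : Prop :=
  graph_dist collinearity_graph x y d.

Definition pseudo_isometric : Prop :=
  forall x y, points O x -> points O y -> x <> y ->
    [/\ octagon_dist x y 1 <-> collinear M x y,
        octagon_dist x y 2 <-> symplectic_points M x y,
        octagon_dist x y 3 <-> special_points M x y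
      & octagon_dist x y 4 <-> opposite_points M x y].

Definition polarising_symp (x S : T) : Prop :=
  [/\ symps M S, pts M S x
    & forall y, points O y -> collinear O x y -> pts M S y].

Definition strongly_polarised : Prop :=
  (forall x, points O x -> exists! S, polarising_symp x S) /\
  (forall x y S S', points O x -> points O y -> x <> y ->
    polarising_symp x S -> polarising_symp y S' ->
    [/\ collinear M x y <-> adjacent_symps M S S',
        symplectic_points M x y <-> symplectic_symps M S S',
        special_points M x y <-> special_symps M S S'
      & opposite_points M x y <-> opposite_symps M S S']).

(* The structure with points and lines the images under theta of the points
   and the lines of O, respectively. *)
Definition dual_octagon (theta : T -> T) : geometry T 2 :=
  subgeometry2 (dual_geometry M) (theta @` points O) (theta @` lines O).

(* Only the values of theta at the points and the lines of O matter. *)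
Definition symmetric_via (theta : T -> T) : Prop :=
  [/\ forall x, points O x -> symps M (theta x) /\
        forall y, points O y -> octagon_dist x y 1 -> pts M (theta x) y,
      forall L, lines O L -> planes M (theta L) /\
        forall x, points O x -> incident O x L ->
          pts M (theta L) `<=` pts M (theta x),
      generalised_octagon (dual_octagon theta)
    & fully_embedded (dual_octagon theta) (dual_geometry M)].

Definition symmetric_embedding : Prop := exists theta, symmetric_via theta.

Definition ovoidal_embedding : Prop :=
  exists theta, symmetric_via theta /\
    forall x, points O x ->
      let Q := symp_gq M x (theta x) in
      ovoid Q (lines O `&` points Q) /\
      ovoid (dual_geometry Q) (lines (dual_octagon theta) `&` lines Q).

Definition dense_embedding : Prop :=
  forall S, symps M S -> exists2 x, points O x & pts M S x.

End Embeddings.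
End Geometries.

(* Main.v *)
(* For a point x of the octagon let x^ = th x be its polarising symp.  Points at
   distance 2 in the octagon have polarising symps meeting in a single point,
   which forces the following: if x,a,b,w is a geodesic of length 3 and c is the
   point of M collinear to x and w, then c is in a^ and b^, but not in x^.

   Dense implies ovoidal.  Each claim follows by looking at the relative
   position of x and a point w of the octagon in a suitable symp S'.  For a
   plane on x in x^, take S' on a line of that plane but not on x; for the
   planes x^ /\ y^ with x, y on a line l of the octagon, take S' meeting a symp
   on l in a plane disjoint from l; for a line on x in x^, take S' meeting x^ in
   a single point of that line.  In all three cases x and w have a common
   neighbour, so they are at distance at most 3 in the octagon.

   Ovoidal implies dense.  If some symp on p contains a line of the octagon all
   of whose points are collinear to p, then p is on the image of a line of the
   octagon, and each symp on p is adjacent or equal to some y^, hence meets the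
   octagon.  So meeting the octagon is inherited by adjacent symps, and M is
   connected.

   The facts on metasymplectic spaces that this needs (two points are on at most
   one line; a point outside a symp is collinear to no point or to the points of
   a line of it) are derived from the axioms by working in the polar spaces of
   the symps and of the point residues. *)

From mathcomp Require Import all_boot.
From mathcomp Require Import boolp classical_sets functions cardinality.
Require Import Defs.

Set Implicit Arguments.
Unset Strict Implicit.
Unset Printing Implicit Defensive.

Local Open Scope classical_set_scope.
Local Open Scope card_scope.

(** * Polar spaces of rank 3 *)

(* Used both for the points, lines and planes of a symp, with containment, and
   for the symps, planes and lines through a point, with reversed containment. *)
Section AbstractPolar.
Variables (T : Type) (P L Q : T -> Prop) (I : T -> T -> Prop).

(** Density yields a single octagon point w in a symp S', with no control over its position. This
    suffices because the neighbours in S' of a point x outside it, if there are any, form a line,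
    and every point of S' is collinear to some point of that line: x and w are never opposite. The
    symp S' is chosen so that this line is known well enough to settle each of the distances 1, 2
    and 3.

    The obstacle is the value of theta at lines. Strong polarisation provides symps for points only,
    and the plane x^ /\ y^ could depend on the choice of x and y on l. The comparison goes through a
    symp s on l that polarises no point of the octagon: a point of s off l and collinear to all of l
    is in z^ for exactly one z on l, whereas a dependence on the choice would put such a point in
    two of the z^.

    Uniqueness in the ovoid conditions comes from points v, v' other than x on two octagon lines
    through x: they are at distance 2, so they are not collinear and their polarising symps share
    only x. *)

Definition joined (x y : T) : Prop := exists2 l, L l & I x l /\ I y l.
Definition within (u v : T) : Prop := forall x, I x u -> I x v.
Definition all_on_line (a b c : T) : Prop :=
  exists2 l, L l & [/\ I a l, I b l & I c l].

(** Containment is expressed through [I], so that it can be reversed in a residue. The last field is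
    supplied for symps by the point residues and for point residues by the symps. *)
Record polar : Prop := Polar {
  line_point : forall l x, L l -> I x l -> P x;
  plane_point : forall q x, Q q -> I x q -> P x;
  line_third : forall l a b, L l -> exists c, [/\ I c l, c <> a & c <> b];
  line_uniq : forall l m x y, L l -> L m -> x <> y ->
    I x l -> I y l -> I x m -> I y m -> l = m;
  joined_refl : forall x, P x -> joined x x;
  joined_proj : forall x l, P x -> L l -> exists2 y, I y l & joined x y;
  joined_line : forall x l y z w, P x -> L l -> I y l -> I z l -> y <> z ->
    joined x y -> joined x z -> I w l -> joined x w;
  not_joined : forall x, P x -> exists2 y, P y & ~ joined x y;
  plane_line : forall q l x y, Q q -> L l -> x <> y -> I x q -> I y q ->
    I x l -> I y l -> within l q;
  plane_joined : forall q x y, Q q -> I x q -> I y q -> joined x y;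
  plane_max : forall q x, Q q -> P x -> (forall y, I y q -> joined x y) -> I x q;
  plane_span : forall a b c, joined a b -> joined a c -> joined b c ->
    ~ all_on_line a b c ->
    exists q, [/\ Q q, I a q, I b q & I c q] /\
      (forall q', Q q' -> I a q' -> I b q' -> I c q' -> within q q') /\
      (forall x, P x -> joined x a -> joined x b -> joined x c ->
         forall y, I y q -> joined x y);
  plane_eq : forall q q', Q q -> Q q' -> within q q' -> within q' q -> q = q';
  plane_off_line : forall q l, Q q -> L l -> exists2 x, I x q & ~ I x l;
  line_two_planes : forall l, L l -> exists q q',
    [/\ Q q, Q q', q <> q', within l q & within l q'] }.

Hypothesis pol : polar.

Lemma joined_sym x y : joined x y -> joined y x.
Proof. by case=> l Ll [xl yl]; exists l. Qed.

Lemma line_joined l x y : L l -> I x l -> I y l -> joined x y.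
Proof. by move=> Ll xl yl; exists l. Qed.

(** Each point of [q'] is joined to all of [q], hence is in [q] by maximality. *)
Lemma plane_sub_eq q q' : Q q -> Q q' -> within q q' -> q = q'.
Proof.
move=> Qq Qq' s; apply: (plane_eq pol) => // y yq'.
apply: (plane_max pol) => // [|z zq]; first exact: (plane_point pol Qq' yq').
exact: (plane_joined pol Qq' yq' (s _ zq)).
Qed.

Lemma span_in_plane q a b c : Q q -> I a q -> I b q -> I c q ->
  ~ all_on_line a b c ->
  (forall q', Q q' -> I a q' -> I b q' -> I c q' -> q' = q) /\
  (forall x, P x -> joined x a -> joined x b -> joined x c ->
     forall y, I y q -> joined x y).
Proof.
move=> Qq aq bq cq nl.
have jn := plane_joined pol Qq.
have [q0 [[Qq0 a0 b0 c0] [min0 jn0]]] :=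
  plane_span pol (jn _ _ aq bq) (jn _ _ aq cq) (jn _ _ bq cq) nl.
have e q' : Q q' -> I a q' -> I b q' -> I c q' -> q' = q0.
  by move=> Qq' a' b' c'; apply/esym/plane_sub_eq => //; apply: min0.
by rewrite (e q Qq aq bq cq).
Qed.

Lemma line_two_points l : L l -> exists a b, [/\ I a l, I b l & a <> b].
Proof.
move=> Ll; have [a [al _ _]] := line_third pol l l Ll.
by have [b [bl ba _]] := line_third pol a a Ll; exists b, a.
Qed.

Lemma line_other l x : L l -> exists2 y, I y l & y <> x.
Proof. by move=> Ll; have [y [yl yx _]] := line_third pol x x Ll; exists y. Qed.

Lemma not_all_on_line l a b c : L l -> I a l -> I b l -> a <> b -> ~ I c l ->
  ~ all_on_line a b c.
Proof.
move=> Ll al bl ab cl [m Lm [am bm cm]]; apply: cl.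
by rewrite (line_uniq pol Ll Lm ab).
Qed.

Lemma plane_joined_all q l c x : Q q -> L l -> within l q -> I c q -> ~ I c l ->
  P x -> (forall y, I y l -> joined x y) -> joined x c ->
  forall y, I y q -> joined x y.
Proof.
move=> Qq Ll lq cq cl Px xl xc.
have [a [b [al bl ab]]] := line_two_points Ll.
have nl := not_all_on_line Ll al bl ab cl.
have [_ H] := span_in_plane Qq (lq _ al) (lq _ bl) cq nl.
by apply: H => //; apply: xl.
Qed.

Lemma plane_uniq q q' l c : Q q -> Q q' -> L l -> within l q -> within l q' ->
  I c q -> I c q' -> ~ I c l -> q = q'.
Proof.
move=> Qq Qq' Ll lq lq' cq cq' cl.
have [a [b [al bl ab]]] := line_two_points Ll.
have nl := not_all_on_line Ll al bl ab cl.
have [e _] := span_in_plane Qq (lq _ al) (lq _ bl) cq nl.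
by apply/esym/e => //; apply: lq'.
Qed.

Lemma plane_of_line l c : L l -> ~ I c l -> (forall y, I y l -> joined c y) ->
  exists q, [/\ Q q, within l q & I c q].
Proof.
move=> Ll cl jn; have [a [b [al bl ab]]] := line_two_points Ll.
have nl := not_all_on_line Ll al bl ab cl.
have [q [[Qq aq bq cq] _]] := plane_span pol (line_joined Ll al bl)
  (joined_sym (jn _ al)) (joined_sym (jn _ bl)) nl.
by exists q; split=> //; apply: (plane_line pol Qq Ll ab).
Qed.

Lemma line_other_plane l q : L l -> exists q', [/\ Q q', q' <> q & within l q'].
Proof.
move=> Ll; have [q1 [q2 [Q1 Q2 ne l1 l2]]] := line_two_planes pol Ll.
have [e|e] := pselect (q1 = q); last by exists q1.
by exists q2; split=> // e2; apply: ne; rewrite e e2.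
Qed.

Lemma line_plane l : L l -> exists2 q, Q q & within l q.
Proof. by move=> /(line_other_plane l) [q [Qq _ lq]]; exists q. Qed.

Lemma plane_diff q q' : Q q -> Q q' -> q <> q' -> exists2 x, I x q & ~ I x q'.
Proof.
move=> Qq Qq' ne; apply: contrapT => H; apply/ne/plane_sub_eq => // x xq.
by apply: contrapT => xq'; apply: H; exists x.
Qed.

(* For x outside q joined to all points of l, the points of q joined to x are
   those of l, and every line has a point joined to x. *)
Lemma lines_meet q l m : Q q -> L l -> L m -> within l q -> within m q ->
  exists2 y, I y l & I y m.
Proof.
move=> Qq Ll Lm lq mq.
have [q' [Qq' ne lq']] := line_other_plane q Ll.
have [x xq' xq] := plane_diff Qq' Qq ne.
have Px := plane_point pol Qq' xq'.
have [y ym xy] := joined_proj pol Px Lm.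
exists y => //; apply: contrapT => yl; apply/xq/(plane_max pol Qq Px).
apply: (plane_joined_all Qq Ll lq (mq _ ym)) => // z zl.
exact: (plane_joined pol Qq' xq' (lq' _ zl)).
Qed.

Lemma plane_has_line q x : Q q -> P x ->
  exists l, [/\ L l, within l q & ~ I x l].
Proof.
move=> Qq /(joined_refl pol) [l0 L0 [x0 _]].
have [a aq al0] := plane_off_line pol Qq L0.
have [l1 L1 [a1 _]] := joined_refl pol (plane_point pol Qq aq).
have [b bq bl1] := plane_off_line pol Qq L1.
have ab : a <> b by move=> e; apply: bl1; rewrite -e.
have [l Ll [al bl]] := plane_joined pol Qq aq bq.
have lq := plane_line pol Qq Ll ab aq bq al bl.
(* If [x] is on [l], a line from [a] to a point of [q] off [l] works: it meets [l] in [a] only, and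
   [a] is not [x]. *)
have [xl|xl] := pselect (I x l); last by exists l.
have [c cq cl] := plane_off_line pol Qq Ll.
have ax : a <> x by move=> e; apply: al0; rewrite e.
have ac : a <> c by move=> e; apply: cl; rewrite -e.
have [m Lm [am cm]] := plane_joined pol Qq aq cq.
exists m; split=> //; first exact: (plane_line pol Qq Lm ac).
by move=> xm; apply: cl; rewrite (line_uniq pol Ll Lm ax).
Qed.

(** Two lines of [q], the second missing the point found on the first, have distinct points joined
    to [x]; these span [n]. One more point of [q] joined to [x] would put [x] in [q] by
    maximality. *)
Lemma perp_plane q x : Q q -> P x -> ~ I x q ->
  exists n, [/\ L n, within n q & forall y, I y q -> (joined x y <-> I y n)].
Proof.
move=> Qq Px xq; have [l [Ll lq _]] := plane_has_line Qq Px.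
have [y yl xy] := joined_proj pol Px Ll.
have [m [Lm mq ym]] := plane_has_line Qq (line_point pol Ll yl).
have [z zm xz] := joined_proj pol Px Lm.
have yz : y <> z by move=> e; apply: ym; rewrite e.
have [n Ln [yn zn]] := plane_joined pol Qq (lq _ yl) (mq _ zm).
have nq := plane_line pol Qq Ln yz (lq _ yl) (mq _ zm) yn zn.
have xn w : I w n -> joined x w.
  exact: (joined_line pol Px Ln yn zn yz xy xz).
exists n; split=> // w wq; split=> [xw|]; last exact: xn.
apply: contrapT => wn; apply/xq/(plane_max pol Qq Px).
exact: (plane_joined_all Qq Ln nq wq wn Px xn xw).
Qed.

(** The point [e] is joined to both lines but lies on [na]. If it is on [nb] too, move it along the
    line of points joined to [b] in a plane on [na]. Otherwise take a third point of the line from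
    [e] to the neighbour [g] of [a] on [nb]: both [e] and [g] are joined to all of [na] and [nb]. *)
Lemma joined_two_lines a b na nb e : L na -> L nb -> I a na -> I b nb ->
  ~ joined a b -> I e na -> (forall y, I y nb -> joined e y) ->
  exists f, [/\ P f, ~ I f na, ~ I f nb,
    forall y, I y na -> joined f y & forall y, I y nb -> joined f y].
Proof.
move=> La Lb ana bnb nab ena eb.
have Pe := line_point pol La ena; have Pa := line_point pol La ana.
have Pb := line_point pol Lb bnb.
have ae : a <> e by move=> ae; apply: nab; rewrite ae; apply: eb.
have [enb|enb] := pselect (I e nb).
  have [q Qq aq] := line_plane La.
  have bq : ~ I b q by move=> bq; apply/nab/(plane_joined pol Qq (aq _ ana) bq).
  have [n [Ln nq bn]] := perp_plane Qq Pb bq.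
  have en : I e n by apply/bn; [exact: aq|apply/joined_sym/eb].
  have [f fn fe] := line_other e Ln.
  have Pf := line_point pol Ln fn.
  have bf : joined b f by apply/bn => //; apply: nq.
  have be : e <> b by move=> E; apply: nab; rewrite -E; apply: (line_joined La).
  have fb y : I y nb -> joined f y.
    apply: (joined_line pol Pf Lb enb bnb be) => //; last exact: joined_sym.
    exact: (line_joined Ln).
  have fa y : I y na -> joined f y.
    by move=> yna; apply: (plane_joined pol Qq); [apply: nq|apply: aq].
  exists f; split=> // fn'.
    apply/nab/joined_sym; apply: (joined_line pol Pb La fn' ena fe) => //.
    exact/joined_sym/eb.
  apply: nab; apply: (joined_line pol Pa Lb fn' enb fe) => //.
    exact/joined_sym/fa.
  exact: (line_joined La).
have [g gnb ag] := joined_proj pol Pa Lb.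
have Pg := line_point pol Lb gnb.
have ga y : I y na -> joined g y.
  apply: (joined_line pol Pg La ana ena ae) => //; first exact: joined_sym.
  exact/joined_sym/eb.
have eg : e <> g by move=> E; apply: enb; rewrite E.
have [k Lk [ek gk]] := eb _ gnb.
have [f [fk fe fg]] := line_third pol e g Lk.
have Pf := line_point pol Lk fk.
have jn l : L l -> (forall y, I y l -> joined e y) ->
    (forall y, I y l -> joined g y) -> forall y, I y l -> joined f y.
  move=> Ll el gl y yl; apply: joined_sym.
  by apply: (joined_line pol (line_point pol Ll yl) Lk ek gk eg) => //;
    apply: joined_sym; [apply: el|apply: gl].
have gb : g <> b by move=> E; apply: nab; rewrite -E.
exists f; split=> //.
- move=> fna; have E := line_uniq pol La Lk (not_eq_sym fe) ena fna ek fk.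
  apply: nab; apply: joined_sym.
  apply: (joined_line pol Pb La (y:=e) (z:=g)) => //; rewrite ?E //.
    exact/joined_sym/eb.
  exact: (line_joined Lb).
- by move=> fnb; apply: enb; rewrite (line_uniq pol Lb Lk fg).
- by apply: jn => // y yna; apply: (line_joined La).
- by apply: jn => // y ynb; apply: (line_joined Lb).
Qed.

(** In a plane [q] on [na], let [e] be joined to [b] and to a second point of [nb]. Then [e] is
    joined to both lines, and [joined_two_lines] moves it off them if necessary. This is the
    position that [perp_symp_clique] needs. *)
Lemma common_neighbour_off_lines a b na nb : L na -> L nb -> I a na ->
  I b nb -> ~ joined a b -> exists f, [/\ P f, ~ I f na, ~ I f nb,
    forall y, I y na -> joined f y & forall y, I y nb -> joined f y].
Proof.
move=> La Lb ana bnb nab; have [q Qq aq] := line_plane La.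
have Pb := line_point pol Lb bnb.
have bq : ~ I b q by move=> bq; apply/nab/(plane_joined pol Qq (aq _ ana) bq).
have [n [Ln nq bn]] := perp_plane Qq Pb bq.
have [c cnb cb] := line_other b Lb.
have [e en ce] := joined_proj pol (line_point pol Lb cnb) Ln.
have Pe := line_point pol Ln en.
have be : joined b e by apply/bn => //; apply: nq.
have eb y : I y nb -> joined e y.
  by apply: (joined_line pol Pe Lb cnb bnb cb); apply: joined_sym.
have ea y : I y na -> joined e y.
  by move=> yna; apply: (plane_joined pol Qq); [apply: nq|apply: aq].
have [ena|ena] := pselect (I e na).
  exact: joined_two_lines nab ena eb.
have [enb|enb] := pselect (I e nb); last by exists e.
have nba : ~ joined b a by move/joined_sym.
have [f [? ? ? ? ?]] := joined_two_lines Lb La bnb ana nba enb ea.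
by exists f.
Qed.

(** Let [k] be a line through [p], not in [q], in a second plane on the line [m] from [p] to a point
    [v] of [l]. Points of [q] joined to all of [k] are on [m], so a plane on [k] can meet [l] only
    in [v]; of two planes on [k], at most one contains [v]. *)
Lemma plane_missing_line l q p : Q q -> L l -> within l q -> I p q -> ~ I p l ->
  exists q', [/\ Q q', I p q' & forall y, I y l -> ~ I y q'].
Proof.
move=> Qq Ll lq pq pl; have [v [_ [vl _ _]]] := line_two_points Ll.
have pv : p <> v by move=> E; apply: pl; rewrite E.
have [m Lm [pm vm]] := plane_joined pol Qq pq (lq _ vl).
have mq := plane_line pol Qq Lm pv pq (lq _ vl) pm vm.
have [q1 [Q1 ne m1]] := line_other_plane q Lm.
have [r r1 rq] := plane_diff Q1 Qq ne.
have Pr := plane_point pol Q1 r1.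
have [n [Ln nq rn]] := perp_plane Qq Pr rq.
have jr y : I y m -> joined r y by move=> ym; apply/(plane_joined pol Q1)/m1.
have nm : n = m.
  by apply: (line_uniq pol Ln Lm pv) => //; apply/rn; do ?[exact: mq|exact: jr].
have pr : p <> r by move=> E; apply: rq; rewrite -E.
have [k Lk [pk rk]] := plane_joined pol Q1 (m1 _ pm) r1.
have vk : ~ I v k.
  move=> vk; apply/rq/mq; rewrite (line_uniq pol Lm Lk pv) //.
have H b : Q b -> within k b -> forall y, I y l -> I y b -> I v b.
  move=> Qb kb y yl yb; suff -> : v = y by [].
  apply: contrapT => vy; have yn : I y n.
    by apply/rn; [exact: lq|apply: (plane_joined pol Qb) => //; apply: kb].
  apply: pl; rewrite nm in yn.
  by rewrite (line_uniq pol Ll Lm vy).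
have [b1 [b2 [B1 B2 ne12 k1 k2]]] := line_two_planes pol Lk.
have [v1|v1] := pselect (I v b1); last first.
  by exists b1; split=> //; [exact: k1|move=> y yl /(H _ B1 k1 _ yl)].
exists b2; split=> //; first exact: k2.
move=> y yl /(H _ B2 k2 _ yl) v2.
exact/ne12/(plane_uniq B1 B2 Lk k1 k2 v1 v2 vk).
Qed.
End AbstractPolar.

Lemma card_avoid T n (A : set T) (s : nat -> T) : `I_n.+1 #<= A ->
  exists2 x, A x & forall i, (i < n)%N -> x <> s i.
Proof.
move=> leA; apply: contrapT => H.
suff : `I_n.+1 #<= `I_n by rewrite card_le_II ltnn.
apply: card_le_trans leA _; apply: card_le_trans (card_image_le s `I_n).
apply: subset_card_le => x Ax; apply: contrapT => xs.
by apply: H; exists x => // i ltin xsi; apply: xs; exists i.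
Qed.

Lemma geometry_disjoint T n (G : geometry T n) i j x : is_geometry G ->
  element G i x -> element G j x -> i = j.
Proof. by case=> _ tr _ ix jx; apply: (tr i j I I); exists x. Qed.

Lemma incident_sym T n (G : geometry T n) x y : incident G x y -> incident G y x.
Proof.
case=> c [i [j [Cc ij ci cj]]]; exists c, j, i; split=> //.
by rewrite eq_sym.
Qed.

Lemma incident_neq T n (G : geometry T n) x y : is_geometry G ->
  incident G x y -> x <> y.
Proof.
move=> gG [c [i [j [Cc ij <- <-]]]] e; move/negP: ij; apply; apply/eqP.
have [_ _ ch] := gG.
by apply: (geometry_disjoint gG (ch _ Cc i)); rewrite e; apply: ch.
Qed.

(** * The abstract axioms hold in polar spaces of rank 3 *)

Section PolarOfSpace.
Variables (T : Type) (G : geometry T 3) (I : T -> T -> Prop).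
Hypotheses (polG : polar_space3 G)
  (lineI : forall x l, lines G l -> (pts G l x <-> I x l))
  (planeI : forall x q, planes G q -> (pts G q x <-> I x q))
  (two_planes : forall l, lines G l -> exists q q',
    [/\ planes G q, planes G q', q <> q', within I l q & within I l q']).

Local Notation J := (joined (lines G) I).

Let gG := polar_geometry polG.

Lemma line_ptsE l x : lines G l -> (pts G l x <-> points G x /\ incident G x l).
Proof.
move=> Ll; split=> [[Px [e|//]]|[Px xl]]; last by split=> //; right.
by rewrite e in Px; have := geometry_disjoint gG Px Ll.
Qed.

(** A point is on any given line or on a line joining it to a point of that line. *)
Lemma collinear_refl x : points G x -> collinear G x x.
Proof.
have [ne _ _] := gG; have [l Ll] := ne (@Ordinal 3 1 isT) => Px.
have [xl|xl] := pselect (incident G x l); first by exists l.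
case: (polar_one_or_all polG Px Ll xl) => [[y [[_ [k Lk [xk _]]] _]]|al].
  by exists k.
have [_ _ ch] := gG.
have [x0 x0l _] := card_avoid (fun=> x) (polar_thick polG Ll).
by have [k Lk [xk _]] := al _ x0l; exists k.
Qed.

Lemma joinedE x y : J x y <-> [/\ points G x, points G y & collinear G x y].
Proof.
split=> [[l Ll [/(lineI _ Ll) xl /(lineI _ Ll) yl]]|[Px Py [l Ll [xl yl]]]].
  have /(line_ptsE _ Ll) [Px ix] := xl; have /(line_ptsE _ Ll) [Py iy] := yl.
  by split=> //; exists l.
by exists l => //; split; apply/(lineI _ Ll)/line_ptsE.
Qed.

Lemma collinear_sym x y : collinear G x y -> collinear G y x.
Proof. by case=> l Ll [xl yl]; exists l. Qed.

Lemma perp_subspace a : points G a ->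
  subspace G [set x | points G x /\ collinear G a x].
Proof.
move=> Pa; split=> [x []//|l x y Ll [Px ax] [Py ay] xy xl yl w wl].
have [Pw iw] := (line_ptsE w Ll).1 wl; split=> //.
have [al|al] := pselect (incident G a l); first by exists l.
case: (polar_one_or_all polG Pa Ll al) => [[z [_ uz]]|]; last exact.
case: xy; transitivity z; [apply/esym|]; apply: uz; split=> //; exact/line_ptsE.
Qed.

Lemma span_subspace (A : set T) : A `<=` points G ->
  subspace G (smallest (subspace G) A).
Proof.
move=> AP; split=> [x sx|l x y Ll sx sy xy xl yl w wl B [sB AB]].
  apply: (sx (points G)); split=> //; split=> // l y z Ll _ _ _ _ _ w.
  by case/(line_ptsE _ Ll).
have [_ cB] := sB; apply: (cB l x y) => //; first exact: sx.
exact: sy.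
Qed.

Lemma span_singular (A : set T) : A `<=` points G ->
  (forall x y, A x -> A y -> collinear G x y) ->
  singular_subspace G (smallest (subspace G) A).
Proof.
move=> AP cA; have sA := span_subspace AP; split=> // x y sx sy _.
have H a : A a -> smallest (subspace G) A `<=` [set x | points G x /\ collinear G a x].
  move=> Aa; apply: smallest_sub; first exact: perp_subspace (AP _ Aa).
  by move=> b Ab; split; [apply: AP|apply: cA].
have Px : points G x by apply: sA.1.
suff /(_ _ sy)[] : smallest (subspace G) A `<=`
  [set z | points G z /\ collinear G x z] by [].
apply: smallest_sub; first exact: perp_subspace.
by move=> a Aa; split; [apply: AP|apply: collinear_sym; case: (H _ Aa _ sx)].
Qed.

Lemma line_subspace l : lines G l -> singular_subspace G (pts G l).
Proof.
by move=> Ll; case: ((polar_lines polG (pts G l)).1 (ex_intro2 _ _ l Ll erefl)).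
Qed.

Lemma plane_subspace q : planes G q -> maximal_singular G (pts G q).
Proof.
by move=> Qq; apply: ((polar_planes_max polG (pts G q)).1 (ex_intro2 _ _ q Qq erefl)).
Qed.

Lemma plane_joined_pts q x y : planes G q -> pts G q x -> pts G q y ->
  collinear G x y.
Proof.
move=> /plane_subspace [[[sP _] cl] _] xq yq; have [->|] := pselect (x = y).
  exact/collinear_refl/sP.
exact: cl.
Qed.

Lemma pts_inj i u j v : element G i u -> element G j v -> pts G u = pts G v -> u = v.
Proof. by have [inj _ _] := polar_identified polG; exact: inj. Qed.

Lemma plane_off_line_pts q l : planes G q -> lines G l ->
  exists2 x, I x q & ~ I x l.
Proof.
move=> Qq Ll; apply: contrapT => H; have [_ mx] := plane_subspace Qq.
suff e : l = q by rewrite e in Ll; have := geometry_disjoint gG Ll Qq.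
apply: (pts_inj Ll Qq); apply: mx; first exact: line_subspace.
move=> x /(planeI _ Qq) xq; apply: contrapT => /(lineI _ Ll) xl.
by apply: H; exists x.
Qed.

(** Applied to a residue this gives two planes on a line of a symp, applied to a symp two lines
    through a point of a plane: each kind of polar space provides the hypothesis [two_planes] for
    the other. *)
Lemma two_lines_in_plane q x : planes G q -> I x q -> exists l l',
  [/\ lines G l /\ lines G l', I x l /\ I x l', l <> l',
      within I l q & within I l' q].
Proof.
move=> Qq /(planeI _ Qq) xq; have [sq _] := plane_subspace Qq.
have lin y : pts G q y -> x <> y ->
    exists l, [/\ lines G l, I x l, I y l & within I l q].
  move=> yq xy; have [l Ll [xl yl]] := sq.2 _ _ xq yq xy.
  have Px := sq.1.1 _ xq; have Py := sq.1.1 _ yq.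
  exists l; split=> //; do ?by apply/(lineI _ Ll)/line_ptsE.
  by move=> z /(lineI _ Ll) zl; apply/(planeI _ Qq)/(sq.1.2 l x y).
have [m Lm [xm _]] := collinear_refl (sq.1.1 _ xq).
have {xm} xm : I x m by apply/(lineI _ Lm)/line_ptsE => //; split=> //; apply: sq.1.1.
have off k : lines G k -> I x k -> exists y, [/\ pts G q y, x <> y & ~ I y k].
  move=> Lk xk; have [y /(planeI _ Qq) yq yk] := plane_off_line_pts Qq Lk.
  by exists y; split=> // e; apply: yk; rewrite -e.
have [y [yq xy _]] := off m Lm xm.
have [l [Ll xl yl lq]] := lin y yq xy.
have [z [zq xz zl]] := off l Ll xl.
have [l' [Ll' xl' zl' lq']] := lin z zq xz.
by exists l, l'; split=> // e; apply: zl; rewrite e.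
Qed.

(** The lower bound in [proj_dim G X 2]: at most two points of [X] are on a common line, which
    contains all that they generate. *)
Lemma not_generated2 X a b c k : singular_subspace G X -> X a -> X b -> X c ->
  ~ all_on_line (lines G) I a b c -> (k <= 2)%N -> ~ generated_by G k X.
Proof.
move=> sX Xa Xb Xc nl k2 [f Pf eX].
suff [m Lm Xm] : exists2 m, lines G m & X `<=` pts G m.
  by apply: nl; exists m => //; split; apply/(lineI _ Lm); apply: Xm.
have Xf i : X (f i) by rewrite eX; apply: sub_gen_smallest; exists i.
have sub m : lines G m -> (forall i, incident G (f i) m) -> X `<=` pts G m.
  move=> Lm fm; rewrite eX; apply: smallest_sub; first exact: (line_subspace Lm).1.
  by move=> _ [i _ <-]; apply/line_ptsE.
have lin x : points G x -> exists2 m, lines G m & incident G x m.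
  by move=> /collinear_refl [m Lm [xm _]]; exists m.
case: k k2 f Pf eX Xf sub => [|[|[|//]]] _ f Pf eX Xf sub.
- have [m Lm _] := lin a (sX.1.1 _ Xa).
  by exists m => //; apply: sub => // -[].
- have [m Lm xm] := lin (f ord0) (Pf _); exists m => //; apply: sub => // i.
  by rewrite ord1.
- have [e|ne] := pselect (f ord0 = f ord_max).
    have [m Lm xm] := lin (f ord0) (Pf _); exists m => //; apply: sub => // i.
    have [->//|->] : i = ord0 \/ i = ord_max; last by rewrite -e.
    by case: i => -[|[|//]] lti; [left|right]; apply/val_inj.
  have [m Lm [x0 x1]] := sX.2 _ _ (Xf ord0) (Xf ord_max) ne.
  exists m => //; apply: sub => // i.
  have [->//|->//] : i = ord0 \/ i = ord_max.
  by case: i => -[|[|//]] lti; [left|right]; apply/val_inj.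
Qed.

Lemma polar_of_space : polar (points G) (lines G) (planes G) I.
Proof.
have pl q : planes G q -> singular_subspace G (pts G q).
  by move=> Qq; case: (plane_subspace Qq).
split.
- by move=> l x Ll /(lineI _ Ll) [].
- by move=> q x Qq /(planeI _ Qq) [].
- move=> l a b Ll.
  have [c cl nc] := card_avoid (fun i => if i == 0 then a else b) (polar_thick polG Ll).
  by exists c; split; [apply/(lineI _ Ll)|apply: (nc 0)|apply: (nc 1)].
- move=> l m x y Ll Lm xy.
  move=> /(lineI _ Ll) xl /(lineI _ Ll) yl /(lineI _ Lm) xm /(lineI _ Lm) ym.
  have sub k k' : lines G k -> lines G k' -> pts G k x -> pts G k y ->
      pts G k' x -> pts G k' y -> pts G k `<=` pts G k'.
    move=> Lk Lk' xk yk xk' yk'; apply: ((line_subspace Lk').1.2 k x y) => //.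
      by case/(line_ptsE _ Lk): xk.
    by case/(line_ptsE _ Lk): yk.
  by apply: (pts_inj Ll Lm); apply/seteqP; split; apply: sub.
- by move=> x Px; apply/joinedE; split=> //; apply: collinear_refl.
- move=> x l Px Ll.
  have [xl|xl] := pselect (incident G x l).
    have xpl : pts G l x by apply/line_ptsE.
    exists x; first exact/(lineI _ Ll).
    by apply/joinedE; split=> //; apply: collinear_refl.
  have [y yl xy] : exists2 y, pts G l y & collinear G x y.
    case: (polar_one_or_all polG Px Ll xl) => [[y [[yl xy] _]]|al]; first by exists y.
    by have [y yl _] := card_avoid (fun=> x) (polar_thick polG Ll); exists y; auto.
  exists y; first exact/(lineI _ Ll).
  by apply/joinedE; split=> //; case: yl.
- move=> x l y z w Px Ll /(lineI _ Ll) yl /(lineI _ Ll) zl yz.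
  move=> /joinedE [_ Py xy] /joinedE [_ Pz xz] /(lineI _ Ll) wl.
  apply/joinedE; suff [] : [set u | points G u /\ collinear G x u] w by [].
  apply: ((perp_subspace Px).2 l y z) => //.
    by case/(line_ptsE _ Ll): yl.
  by case/(line_ptsE _ Ll): zl.
- move=> x Px; have [y [Py _ xy]] := polar_nondegenerate polG Px.
  by exists y => // /joinedE [].
- move=> q l x y Qq Ll xy /(planeI _ Qq) xq /(planeI _ Qq) yq.
  move=> /(lineI _ Ll) xl /(lineI _ Ll) yl z /(lineI _ Ll) zl.
  apply/(planeI _ Qq); apply: ((pl _ Qq).1.2 l x y) => //.
    by case/(line_ptsE _ Ll): xl.
  by case/(line_ptsE _ Ll): yl.
- move=> q x y Qq /(planeI _ Qq) xq /(planeI _ Qq) yq.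
  apply/joinedE; split; [exact: ((pl _ Qq).1.1 _ xq)|exact: ((pl _ Qq).1.1 _ yq)|].
  exact: plane_joined_pts Qq xq yq.
- move=> q x Qq Px xq; apply/(planeI _ Qq).
  have [sq mx] := plane_subspace Qq.
  have xC y : pts G q y -> collinear G x y.
    by move=> yq; have /joinedE [] := xq _ ((planeI _ Qq).1 yq).
  (* The span of [x] and [q] is singular, so it is [q] by maximality. *)
  pose A := x |` pts G q.
  have AP : A `<=` points G by move=> y [->//|/sq.1.1].
  have sA : singular_subspace G (smallest (subspace G) A).
    apply: span_singular => // y z [->|yq] [->|zq].
    + exact: collinear_refl.
    + exact: xC.
    + exact/collinear_sym/xC.
    + exact: (plane_joined_pts Qq).
  have <- : smallest (subspace G) A = pts G q.
    by apply: mx => // y yq; apply: sub_gen_smallest; right.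
  by apply: sub_gen_smallest; left.
- move=> a b c /joinedE [Pa Pb ab] /joinedE [_ Pc ac] /joinedE [_ _ bc] nl.
  (* The span of [a], [b], [c] is singular of projective dimension 2, hence a plane. The other two
     clauses hold because a plane and the perp of a point are subspaces. *)
  pose f (i : 'I_3) := if val i == 0 then a else if val i == 1 then b else c.
  have AP : range f `<=` points G.
    by move=> _ [i _ <-]; rewrite /f; do 2?case: ifP.
  have sA : singular_subspace G (smallest (subspace G) (range f)).
    apply: span_singular => // _ _ [i _ <-] [j _ <-]; rewrite /f.
    do 4?case: ifP => _; by [|exact: collinear_refl|exact: collinear_sym].
  have fA i : smallest (subspace G) (range f) (f i).
    by apply: sub_gen_smallest; exists i.
  have fa : smallest (subspace G) (range f) a := fA ord0.
  have fb : smallest (subspace G) (range f) b := fA (@Ordinal 3 1 isT).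
  have fc : smallest (subspace G) (range f) c := fA ord_max.
  have [q Qq eq] : exists2 q, planes G q & pts G q = smallest (subspace G) (range f).
    apply/(polar_planes polG); split=> //; split; first by exists f => // i; apply: AP; exists i.
    move=> k k2; exact: (not_generated2 sA fa fb fc nl k2).
  exists q; split; last split.
  + by split=> //; apply/(planeI _ Qq); rewrite eq.
  + move=> q' Qq' /(planeI _ Qq') a' /(planeI _ Qq') b' /(planeI _ Qq') c' x.
    move=> /(planeI _ Qq); rewrite eq => xq; apply/(planeI _ Qq').
    apply: xq; split; first exact: (pl _ Qq').1.
    by move=> _ [i _ <-]; rewrite /f; do 2?case: ifP.
  + move=> x Px /joinedE [_ _ xa] /joinedE [_ _ xb] /joinedE [_ _ xc] y.
    move=> /(planeI _ Qq); rewrite eq => yq; apply/joinedE.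
    suff [] : [set u | points G u /\ collinear G x u] y by [].
    apply: yq; split; first exact: perp_subspace.
    by move=> _ [i _ <-]; rewrite /f; do 2?case: ifP.
- move=> q q' Qq Qq' qq' q'q; apply: (pts_inj Qq Qq'); apply/seteqP; split=> x.
    by move=> /(planeI _ Qq) /qq' /(planeI _ Qq').
  by move=> /(planeI _ Qq') /q'q /(planeI _ Qq).
- exact: plane_off_line_pts.
- exact: two_planes.
Qed.
End PolarOfSpace.

(** * Walks and generalised octagons *)

(* A shortest closed subwalk of a non-backtracking walk is a circuit. *)
Lemma nonbacktracking_injective T (E : T -> T -> Prop) (n : nat) (f : nat -> T) :
  (forall x, ~ E x x) -> (forall k, (k <= n)%N -> ~ graph_circuit E k) ->
  (forall i, (i < n)%N -> E (f i) (f i.+1)) ->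
  (forall i, (i.+1 < n)%N -> f i <> f i.+2) ->
  forall i j, (i < j <= n)%N -> f i <> f j.
Proof.
move=> irr noc step nb i j ij; have [g gE] : exists g, g = (j - i)%N by exists (j - i)%N.
elim/ltn_ind: g i j ij gE => g IH i j /andP[ij jn] gE fij.
have jE : j = (i + g)%N by rewrite gE subnKC // ltnW.
case: g gE IH jE => [|[|[|g]]] gE IH jE.
- by rewrite jE addn0 ltnn in ij.
- by apply: (irr (f i)); rewrite {2}fij jE addn1; apply: step; rewrite -addn1 -jE.
- by apply: (nb i); rewrite ?addn2 in jE; rewrite -jE.
apply: (noc g.+3); first by rewrite gE; apply: leq_trans (leq_subr _ _) jn.
split=> //; exists (fun k : 'I_g.+3 => f (i + k)%N) => [k k'|k].
  move=> fk; apply/val_inj/eqP; apply: contraT => /eqP kk'.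
  have H (a b : 'I_g.+3) : (a < b)%N -> f (i + a)%N <> f (i + b)%N.
    move=> ab; apply: (IH (b - a)%N); last by rewrite subnDl.
      by apply: leq_ltn_trans (leq_subr _ _) (ltn_ord b).
    rewrite ltn_add2l ab /=; apply: leq_trans jn; rewrite jE leq_add2l.
    exact/ltnW/ltn_ord.
  have [kk|kk|kk] := ltngtP k k'; first by case: (H _ _ kk fk).
    by case: (H _ _ kk (esym fk)).
  by case: kk'.
have lk := ltn_ord k; rewrite /=.
have [k1|k1] := ltnP k.+1 g.+3.
  rewrite modn_small // addnS; apply: step.
  by apply: leq_trans jn; rewrite jE -addnS leq_add2l ltnW.
have ke : k.+1 = g.+3 by apply/eqP; rewrite eqn_leq lk k1.
have ike : (i + g.+3 = (i + k).+1)%N by rewrite -addnS ke.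
rewrite ke modnn addn0 fij jE ike; apply: step.
by apply: leq_trans jn; rewrite jE ike.
Qed.

Lemma walk_rcons U (E : U -> U -> Prop) k x y z :
  walk E k x y -> E y z -> walk E k.+1 x z.
Proof.
elim: k x => [x /= -> yz|k IH x [w xw wy] yz]; first by exists z.
by exists w => //; apply: IH.
Qed.

Lemma walk_sym U (E : U -> U -> Prop) k x y : (forall u v, E u v -> E v u) ->
  walk E k x y -> walk E k y x.
Proof.
move=> Es; elim: k x => [x /= //|k IH x [w xw wy]].
by apply: (walk_rcons (IH _ wy)); apply: Es.
Qed.

Lemma walk_dist U (E : U -> U -> Prop) k x y : walk E k x y ->
  exists2 d, (d <= k)%N & graph_dist E x y d.
Proof.
elim/ltn_ind: k => k IH w.
have [[m mk wm]|H] := pselect (exists2 m, (m < k)%N & walk E m x y).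
  by have [d dm gd] := IH m mk wm; exists d => //; apply: leq_trans dm (ltnW mk).
by exists k => //; split=> // m mk wm; apply: H; exists m.
Qed.

Lemma subgeometry2_incident T n (G : geometry T n) (A B : set T) u v :
  incident (subgeometry2 G A B) u v -> incident G u v.
Proof.
move=> [c [i [j [[_ _ Cc] ij <- <-]]]].
have ordP (k : 'I_2) : k = ord0 \/ k = ord_max.
  by case: k => -[|[|//]] ltk; [left|right]; apply/val_inj.
by case: (ordP i) (ordP j) ij => -> [] -> // _; apply: incident_sym.
Qed.

Lemma incident_subgeometry2 T n (G : geometry T n) (A B : set T) u v :
  A u -> B v -> incident G u v -> incident (subgeometry2 G A B) u v.
Proof.
move=> Au Bv uv; exists (fun i => if i == ord0 then u else v), ord0, ord_max.
by split.
Qed.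

Lemma dual_incident T n (G : geometry T n) u v :
  incident (dual_geometry G) u v <-> incident G u v.
Proof.
split=> -[c [i [j [Cc ij <- <-]]]].
  exists (fun k => c (rev_ord k)), (rev_ord i), (rev_ord j).
  by split; rewrite ?rev_ordK // (inj_eq rev_ord_inj).
exists (fun k => c (rev_ord k)), (rev_ord i), (rev_ord j).
split; rewrite ?rev_ordK ?(inj_eq rev_ord_inj) //=.
by under boolp.eq_fun do rewrite rev_ordK.
Qed.

Lemma elements2E T (G : geometry T 2) u : elements G u <-> points G u \/ lines G u.
Proof.
split=> [[[[|[|//]] lti] iu]|[Pu|Lu]].
- by left; rewrite /points (_ : Ordinal _ = Ordinal lti) //; apply/val_inj.
- by right; rewrite /lines (_ : Ordinal _ = Ordinal lti) //; apply/val_inj.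
- by exists (@Ordinal 2 0 isT).
- by exists (@Ordinal 2 1 isT).
Qed.

Lemma incident_elements T n (G : geometry T n) u v : is_geometry G ->
  incident G u v -> elements G u /\ elements G v.
Proof.
by move=> [_ _ ch] [c [i [j [Cc _ <- <-]]]]; split; [exists i|exists j]; apply: ch.
Qed.

(** * Transport of generalised octagons along isomorphisms *)

Section OctagonTransport.
Variables (T : Type) (G G' : geometry T 2) (f : T -> T).
Hypotheses (gG' : is_geometry G') (ptsG' : points G' = f @` points G)
  (linesG' : lines G' = f @` lines G)
  (f_inj : forall u v, elements G u -> elements G v -> f u = f v -> u = v)
  (f_inc : forall u v, elements G u -> elements G v ->
     (incident G u v <-> incident G' (f u) (f v))).

Lemma image_element u : elements G u -> elements G' (f u).
Proof.
move=> /elements2E [Pu|Lu]; apply/elements2E.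
  by left; rewrite ptsG'; exists u.
by right; rewrite linesG'; exists u.
Qed.

Lemma element_preimage u' : elements G' u' -> exists2 u, elements G u & f u = u'.
Proof.
move=> /elements2E; rewrite ptsG' linesG' => -[] [u Gu <-]; exists u => //;
  by apply/elements2E; auto.
Qed.

Lemma walk_image k u v : is_geometry G -> elements G u -> elements G v ->
  (walk (incident G) k u v <-> walk (incident G') k (f u) (f v)).
Proof.
move=> gG; elim: k u => [u|k IH u] Gu Gv /=; first by split=> [->|/f_inj]; auto.
split=> [[w uw wv]|[w' uw' wv]].
  have [_ Gw] := incident_elements gG uw.
  by exists (f w); [apply/f_inc|apply/IH].
have [_ /element_preimage [w Gw e]] := incident_elements gG' uw'.
by rewrite -e in uw' wv; exists w; [apply/f_inc|apply/IH].
Qed.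

Lemma circuit_image k : is_geometry G ->
  graph_circuit (incident G) k <-> graph_circuit (incident G') k.
Proof.
move=> gG; split=> -[k3 [c cI cE]]; split=> //.
  have Gc i : elements G (c i) by case: (incident_elements gG (cE i)).
  by exists (f \o c) => [i j /f_inj|i] /=; [move/(_ (Gc i) (Gc j))/cI|apply/f_inc].
have Gc i : {u | elements G u /\ f u = c i}.
  apply: cid; have [Gi _] := incident_elements gG' (cE i).
  by have [u] := element_preimage Gi; exists u.
exists (fun i => sval (Gc i)) => [i j|i].
  by case: (Gc i) => u /= [_ e]; case: (Gc j) => v /= [_ e'] uv; apply: cI; rewrite -e -e' uv.
case: (Gc i) (Gc (ordS i)) => u /= [Gu e] [v /= [Gv e']]; apply/f_inc => //.
by rewrite e e'.
Qed.

Lemma card_image_set (A B : set T) U (t : set U) : (forall u, A u -> elements G u) ->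
  B = f @` A -> A #= t -> B #= t.
Proof.
move=> AG ->; apply: card_eq_trans; apply: inj_card_eq => u v.
by rewrite !inE => /AG Gu /AG Gv; apply: f_inj.
Qed.

Lemma octagon_image : generalised_octagon G -> generalised_octagon G'.
Proof.
move=> [gG [dG [u [v [Gu Gv [duv nuv]]]]] [gc gmin] [s [t [s2 t2 cP cL]]]]; split=> //.
- split=> [u' v' /element_preimage [a Ga <-] /element_preimage [b Gb <-]|].
    by have [k k8 w] := dG a b Ga Gb; exists k => //; apply/walk_image.
  exists (f u), (f v); split; [exact: image_element|exact: image_element|].
  split; first exact/walk_image.
  by move=> k k8 w; apply: (nuv k k8); apply/walk_image.
- split; first exact/circuit_image.
  by move=> k /circuit_image c; apply/gmin/c.
- have EP u' : points G u' -> elements G u' by move=> ?; apply/elements2E; left.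
  have EL u' : lines G u' -> elements G u' by move=> ?; apply/elements2E; right.
  exists s, t; split=> //.
    rewrite ptsG' => _ [p Pp <-]; apply: (card_image_set _ _ (cP p Pp)).
      by move=> l [Ll _]; apply: EL.
    rewrite linesG'; apply/seteqP; split=> [_ [[l Ll <-] pl]|_ [l [Ll pl] <-]] /=.
      by exists l => //; split=> //; apply/f_inc; auto.
    by split; [exists l|apply/f_inc; auto].
  rewrite linesG' => _ [l Ll <-]; apply: (card_image_set _ _ (cL l Ll)).
    by move=> p [Pp _]; apply: EP.
  rewrite ptsG'; apply/seteqP; split=> [_ [[p Pp <-] pl]|_ [p [Pp pl] <-]] /=.
    by exists p => //; split=> //; apply/f_inc; auto.
  by split; [exists p|apply/f_inc; auto].
Qed.
End OctagonTransport.

(** * Metasymplectic spaces *)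

Section Metasymplectic.
Variables (T : Type) (M : geometry T 4).
Hypothesis msM : metasymplectic_space M.

Local Notation on := (fun x u => pts M u x).
Local Notation "u =< v" := (pts M u `<=` pts M v) (at level 70).

Let gM := ms_geometry msM.
Let i0 : 'I_4 := @Ordinal 4 0 isT.
Let i1 : 'I_4 := @Ordinal 4 1 isT.
Let i2 : 'I_4 := @Ordinal 4 2 isT.
Let i3 : 'I_4 := @Ordinal 4 3 isT.

Lemma ord4P (Z : 'I_4 -> Prop) : Z i0 -> Z i1 -> Z i2 -> Z i3 -> forall i, Z i.
Proof.
move=> z0 z1 z2 z3 [[|[|[|[|//]]]] lti].
- by rewrite (_ : Ordinal lti = i0) //; apply/val_inj.
- by rewrite (_ : Ordinal lti = i1) //; apply/val_inj.
- by rewrite (_ : Ordinal lti = i2) //; apply/val_inj.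
- by rewrite (_ : Ordinal lti = i3) //; apply/val_inj.
Qed.

Lemma pts_point u x : pts M u x -> points M x.
Proof. by case. Qed.

Lemma point_pts x : points M x -> pts M x = [set x].
Proof.
move=> Px; apply/seteqP; split=> [y [Py [//|yx]]|y ->]; last by split=> //; left.
case: yx => c [i [j [Cc ij ci cj]]]; have [_ _ ch] := gM.
have ei := ch _ Cc i; have ej := ch _ Cc j; rewrite ci in ei; rewrite cj in ej.
move/negP: ij; case; apply/eqP; rewrite (geometry_disjoint gM ei Py).
by rewrite (geometry_disjoint gM ej Px).
Qed.

Lemma point_subE x u : points M x -> (x =< u <-> pts M u x).
Proof. by move=> Px; rewrite point_pts //; split=> [|xu y ->//]; apply. Qed.

Lemma incidentE (i j : 'I_4) u v : (i < j)%N -> element M i u -> element M j v ->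
  (incident M u v <-> u =< v).
Proof. by have [_ H _] := ms_identified msM; apply: H. Qed.

Definition flag4 (x l q s : T) (i : 'I_4) : T := nth x [:: x; l; q; s] i.

Lemma chamber_flag x l q s : points M x -> lines M l -> planes M q -> symps M s ->
  pts M l x -> l =< q -> q =< s -> chamber M (flag4 x l q s).
Proof.
move=> Px Ll Qq Ss xl lq qs; have [_ _ H] := ms_identified msM; apply/H.
have el : forall i, element M i (flag4 x l q s i) by apply: ord4P.
split=> // i j ij; apply/(incidentE ij) => //.
have xl' : x =< l by apply/point_subE.
have xq := subset_trans xl' lq; have ls := subset_trans lq qs.
move: i j ij; apply: ord4P; apply: ord4P => // _.
exact: subset_trans xl' ls.
Qed.

(** Connectedness gives a walk to an element of another type; it is not empty, and its first
    incidence comes from a chamber. *)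
Lemma in_chamber i u : element M i u -> exists2 c, chamber M c & c i = u.
Proof.
move=> iu; have [ne _ ch] := gM.
have [j ij] : exists j : 'I_4, i <> j.
  by move: (i); apply: ord4P; [exists i1|exists i0..].
have [v jv] := ne j.
have [k] := ms_connected msM (ex_intro _ i iu) (ex_intro _ j jv).
case: k => [uv|k [w [c [i' [j' [Cc _ ci _]]]] _]].
  by rewrite /= in uv; rewrite uv in iu; case: ij; apply: geometry_disjoint iu jv.
have iu' := ch _ Cc i'; rewrite ci in iu'.
by exists c => //; rewrite (geometry_disjoint gM iu iu').
Qed.

Lemma chamberP c : chamber M c ->
  [/\ points M (c i0), lines M (c i1), planes M (c i2) & symps M (c i3)] /\
  [/\ pts M (c i1) (c i0), c i1 =< c i2 & c i2 =< c i3].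
Proof.
move=> Cc; have [_ _ ch] := gM; have el := ch _ Cc; split; first by split; apply: el.
have inc (i j : 'I_4) : (i < j)%N -> c i =< c j.
  move=> ij; apply/(incidentE ij (el i) (el j)).
  by exists c, i, j; split=> //; apply/eqP => e; rewrite e ltnn in ij.
split; [|exact: inc|exact: inc].
by have /(point_subE _ (el i0)) := inc i0 i1 isT.
Qed.

Lemma incident_chamber i j u v : element M i u -> element M j v ->
  incident M u v -> exists2 c, chamber M c & c i = u /\ c j = v.
Proof.
move=> iu jv [c [i' [j' [Cc _ ci cj]]]]; have [_ _ ch] := gM.
have iu' := ch _ Cc i'; rewrite ci in iu'; have jv' := ch _ Cc j'; rewrite cj in jv'.
by exists c => //; rewrite (geometry_disjoint gM iu iu') (geometry_disjoint gM jv jv').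
Qed.

Lemma sub_chamber (i j : 'I_4) u v : (i < j)%N -> element M i u -> element M j v ->
  u =< v -> exists2 c, chamber M c & c i = u /\ c j = v.
Proof. by move=> ij iu jv /(incidentE ij iu jv); apply: incident_chamber. Qed.

Lemma line_in_plane l s : lines M l -> symps M s -> l =< s ->
  exists q, [/\ planes M q, l =< q & q =< s].
Proof.
move=> Ll Ss ls; have [c Cc [<- <-]] := @sub_chamber i1 i3 _ _ isT Ll Ss ls.
by have [[_ _ Qc _] [_ ? ?]] := chamberP Cc; exists (c i2).
Qed.

Lemma line_between x q : points M x -> planes M q -> pts M q x ->
  exists l, [/\ lines M l, pts M l x & l =< q].
Proof.
move=> Px Qq /(point_subE _ Px) xq.
have [c Cc [<- <-]] := @sub_chamber i0 i2 _ _ isT Px Qq xq.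
by have [[_ Lc _ _] [? ? _]] := chamberP Cc; exists (c i1).
Qed.

Lemma plane_above l : lines M l -> exists q s,
  [/\ planes M q, symps M s, l =< q & q =< s].
Proof.
move=> Ll; have [c Cc <-] := @in_chamber i1 _ Ll.
by have [[_ _ ? ?] [_ ? ?]] := chamberP Cc; exists (c i2), (c i3).
Qed.

Lemma symp_above q : planes M q -> exists2 s, symps M s & q =< s.
Proof.
move=> Qq; have [c Cc <-] := @in_chamber i2 _ Qq.
by have [[_ _ _ ?] [_ _ ?]] := chamberP Cc; exists (c i3).
Qed.

(** * The polar space of a symp *)

Section Shadow.
Variable s : T.
Hypothesis Ss : symps M s.
Let G := shadow_geometry M i3 s.
Let polG : polar_space3 G := ms_shadow msM Ss.

Lemma shadow_element (j : 'I_3) (k : 'I_4) : val j = val k ->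
  element G j = [set u | element M k u /\ u =< s].
Proof.
move=> jk; have lt : (k < i3)%N by rewrite -jk; apply: ltn_ord.
apply/seteqP; rewrite /= (_ : widen_ord _ j = k); last exact/val_inj.
by split=> u /= [ku /(incidentE lt ku Ss)].
Qed.

Lemma shadow_points : points G = [set x | pts M s x].
Proof.
rewrite /points (@shadow_element _ i0) //; apply/seteqP; split=> x /=.
  by case=> Px /(point_subE _ Px).
by move=> xs; have Px := pts_point xs; split=> //; apply/point_subE.
Qed.

Lemma shadow_lines : lines G = [set l | lines M l /\ l =< s].
Proof. exact: shadow_element. Qed.

Lemma shadow_planes : planes G = [set q | planes M q /\ q =< s].
Proof. exact: shadow_element. Qed.

Lemma shadow_incident u v : incident G u v -> incident M u v.
Proof.
move=> [d [i [j [[c [Cc _ dc]] ij di dj]]]].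
exists c, (widen_ord (ltnW (ltn_ord i3)) i), (widen_ord (ltnW (ltn_ord i3)) j).
by split; rewrite -?dc.
Qed.

Lemma shadow_incident_flag x l q : points M x -> lines M l -> planes M q ->
  pts M l x -> l =< q -> q =< s -> incident G x l /\ incident G x q.
Proof.
move=> Px Ll Qq xl lq qs; have Cc := chamber_flag Px Ll Qq Ss xl lq qs.
pose d (j : 'I_3) := flag4 x l q s (widen_ord (ltnW (ltn_ord i3)) j).
have Gd : chamber G d by exists (flag4 x l q s).
by split; [exists d, ord0, (@Ordinal 3 1 isT)|exists d, ord0, ord_max].
Qed.

Lemma shadow_line_pts x l : lines G l -> (pts G l x <-> pts M l x).
Proof.
rewrite shadow_lines => -[Ll ls]; split=> [[Px xl]|xl].
  case: xl => [e|/shadow_incident xl]; last first.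
    by move: Px; rewrite shadow_points => /pts_point Px; split=> //; right.
  rewrite e in Px; move: Px; rewrite shadow_points => /pts_point Px.
  by have := geometry_disjoint gM Px Ll.
have [q [Qq lq qs]] := line_in_plane Ll Ss ls; have Px := pts_point xl.
split; first by rewrite shadow_points; apply: ls.
by right; apply: (shadow_incident_flag Px Ll Qq xl lq qs).1.
Qed.

Lemma shadow_plane_pts x q : planes G q -> (pts G q x <-> pts M q x).
Proof.
rewrite shadow_planes => -[Qq qs]; split=> [[Px xq]|xq].
  case: xq => [e|/shadow_incident xq]; last first.
    by move: Px; rewrite shadow_points => /pts_point Px; split=> //; right.
  rewrite e in Px; move: Px; rewrite shadow_points => /pts_point Px.
  by have := geometry_disjoint gM Px Qq.
have Px := pts_point xq; have [l [Ll xl lq]] := line_between Px Qq xq.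
split; first by rewrite shadow_points; apply: qs.
by right; apply: (shadow_incident_flag Px Ll Qq xl lq qs).2.
Qed.

Lemma shadow_two_lines q x : planes M q -> q =< s -> pts M q x ->
  exists l l', [/\ lines M l /\ lines M l', pts M l x /\ pts M l' x, l <> l',
    l =< q & l' =< q].
Proof.
move=> Qq qs xq; have Gq : planes G q by rewrite shadow_planes.
have [l [l' [[]]]] := two_lines_in_plane polG shadow_line_pts shadow_plane_pts Gq xq.
by rewrite !shadow_lines => -[Ll _] [Ll' _] ? ? ? ?; exists l, l'.
Qed.
End Shadow.

(** * The polar space of the symps, planes and lines on a point *)

Section Residue.
Variable p : T.
Hypothesis Pp : points M p.
Let G : geometry T 3 := dual_geometry (residue_geometry M i0 p).
Let polG : polar_space3 G := ms_residue msM Pp.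
(** Type [j] of the dual of the residue is type [3 - j] of [M]. *)
Let w (j : 'I_3) : 'I_4 := cast_ord (subnKC (ltn_ord i0)) (rshift 1 (rev_ord j)).
Definition through (x u : T) : Prop := symps M x /\ u =< x.

Lemma residue_element (j : 'I_3) (k : 'I_4) : (3 - j = k)%N ->
  element G j = [set u | element M k u /\ pts M u p].
Proof.
move=> jk; have lt : (i0 < k)%N by rewrite -jk; case: j {jk} => -[|[|[|]]].
have -> : element G j = [set u | element M (w j) u /\ incident M u p] by [].
rewrite (_ : w j = k); last by apply/val_inj; rewrite /= -jk; case: j {jk} => -[|[|[|]]].
apply/seteqP; split=> u /= [ku ip]; split=> //.
  by apply/point_subE => //; apply/(incidentE lt Pp ku)/incident_sym.
by apply/incident_sym/(incidentE lt Pp ku)/point_subE.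
Qed.

Lemma residue_points : points G = [set s | symps M s /\ pts M s p].
Proof. exact: residue_element. Qed.

Lemma residue_lines : lines G = [set q | planes M q /\ pts M q p].
Proof. exact: residue_element. Qed.

Lemma residue_planes : planes G = [set l | lines M l /\ pts M l p].
Proof. exact: residue_element. Qed.

Lemma residue_incident u v : incident G u v -> incident M u v.
Proof.
move=> [d [i [j [[c [Cc _ dc]] ij di dj]]]].
have dE k : d k = c (w k).
  have := dc (rev_ord k); rewrite /= rev_ordK => ->; congr c.
exists c, (w i), (w j); split; rewrite -?dE //.
apply/eqP => /(congr1 val) /addnI e; move/eqP: ij; apply.
exact/rev_ord_inj/val_inj.
Qed.

Lemma residue_incident_flag l q s : lines M l -> planes M q -> symps M s ->
  pts M l p -> l =< q -> q =< s -> incident G s q /\ incident G s l.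
Proof.
move=> Ll Qq Ss pl lq qs; have Cc := chamber_flag Pp Ll Qq Ss pl lq qs.
pose d (j : 'I_3) := flag4 p l q s (w j).
have Gd : chamber G d.
  by exists (flag4 p l q s); split=> // j; rewrite /d /w rev_ordK.
by split; [exists d, ord0, (@Ordinal 3 1 isT)|exists d, ord0, ord_max].
Qed.

Lemma residue_pts s u k : element M k u -> (0 < k)%N -> pts M u p ->
  (symps M s -> u =< s -> incident G s u) ->
  (pts G u s <-> through s u).
Proof.
move=> ku k0 up H; split=> [[]|[Ss us]]; last first.
  by split; [rewrite residue_points; split=> //; apply: us|right; apply: H].
rewrite residue_points => -[Ss _] [<-//|/residue_incident su]; split=> //.
have [k3|k3] := ltnP k 3; first exact: ((@incidentE k i3 u s k3 ku Ss).1 (incident_sym su)).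
have ek : k = i3 by apply/val_inj/eqP; rewrite eqn_leq k3 -ltnS ltn_ord.
rewrite ek in ku; case: su => c [i [j [Cc ij ci cj]]]; have [_ _ ch] := gM.
have ei := ch _ Cc i; have ej := ch _ Cc j; rewrite ci in ei; rewrite cj in ej.
move/negP: ij; case; apply/eqP; rewrite (geometry_disjoint gM ei Ss).
by rewrite (geometry_disjoint gM ej ku).
Qed.

Lemma residue_line_pts s q : lines G q -> (pts G q s <-> through s q).
Proof.
rewrite residue_lines => -[Qq pq]; apply: (@residue_pts s q i2) => // Ss qs.
have [l [Ll pl lq]] := line_between Pp Qq pq.
exact: (residue_incident_flag Ll Qq Ss pl lq qs).1.
Qed.

Lemma residue_plane_pts s l : planes G l -> (pts G l s <-> through s l).
Proof.
rewrite residue_planes => -[Ll pl]; apply: (@residue_pts s l i1) => // Ss ls.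
have [q [Qq lq qs]] := line_in_plane Ll Ss ls.
exact: (residue_incident_flag Ll Qq Ss pl lq qs).2.
Qed.

Lemma residue_two_planes l s : lines M l -> pts M l p -> symps M s -> l =< s ->
  exists q q', [/\ planes M q /\ planes M q', q =< s /\ q' =< s, q <> q',
    l =< q & l =< q'].
Proof.
move=> Ll pl Ss ls; have Gl : planes G l by rewrite residue_planes.
have sl : through s l by [].
have [q [q' [[Gq Gq'] [[_ qs] [_ qs']] ne lq lq']]] :=
  two_lines_in_plane polG residue_line_pts residue_plane_pts Gl sl.
have [_ inc _] := polar_identified polG.
(* Containment between sets of symps becomes containment of point sets by way of incidence:
   [polar_identified] turns the former into incidence in the residue. *)
have sub r : lines G r -> within through r l -> l =< r.
  move=> Gr rl; have [Qr _] : planes M r /\ pts M r p by move: Gr; rewrite residue_lines.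
  have rl' : incident G r l.
    have Gl' : element G (@Ordinal 3 2 isT) l := Gl.
    apply: (inc (@Ordinal 3 1 isT) (@Ordinal 3 2 isT) r l isT Gr Gl').2 => t.
    by move=> /(residue_line_pts _ Gr)/rl/(residue_plane_pts _ Gl).
  by apply: ((@incidentE i1 i2 l r isT Ll Qr).1); apply/incident_sym/residue_incident.
have plane r : lines G r -> planes M r by rewrite residue_lines => -[].
by exists q, q'; split; [split; apply: plane|split| |apply: sub|apply: sub].
Qed.
End Residue.

Lemma line_has_point l s : lines M l -> symps M s -> l =< s ->
  exists x, pts M l x.
Proof.
move=> Ll Ss ls; have Gl : lines (shadow_geometry M i3 s) l by rewrite shadow_lines.
have [x xl _] := card_avoid (fun=> l) (polar_thick (ms_shadow msM Ss) Gl).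
by exists x; apply/(shadow_line_pts Ss x Gl).
Qed.

Lemma symp_polar s : symps M s -> polar (fun x => pts M s x)
  (fun l => lines M l /\ l =< s) (fun q => planes M q /\ q =< s) (fun x u => pts M u x).
Proof.
move=> Ss; have := @polar_of_space T _ (fun x u => pts M u x) (ms_shadow msM Ss).
rewrite shadow_points // shadow_lines // shadow_planes //; apply.
- by move=> x l [Ll ls]; apply: shadow_line_pts; rewrite ?shadow_lines.
- by move=> x l [Ll ls]; apply: shadow_plane_pts; rewrite ?shadow_planes.
- move=> l [Ll ls]; have [p pl] := line_has_point Ll Ss ls.
  have [q [q' [[? ?] [? ?] ? ? ?]]] := residue_two_planes (pts_point pl) Ll pl Ss ls.
  by exists q, q'.
Qed.

Lemma residue_polar p : points M p -> polar (fun s => symps M s /\ pts M s p)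
  (fun q => planes M q /\ pts M q p) (fun l => lines M l /\ pts M l p) through.
Proof.
move=> Pp; have := @polar_of_space T _ through (ms_residue msM Pp).
rewrite residue_points // residue_lines // residue_planes //; apply.
- by move=> s q [Qq pq]; apply: residue_line_pts; rewrite ?residue_lines.
- by move=> s l [Ll pl]; apply: residue_plane_pts; rewrite ?residue_planes.
- move=> q [Qq pq]; have [s Ss qs] := symp_above Qq.
  have [l [l' [[? ?] [? ?] ? lq lq']]] := shadow_two_lines Ss Qq qs pq.
  exists l, l'; split=> // t [St qt]; split=> //.
    exact: subset_trans lq qt.
  exact: subset_trans lq' qt.
Qed.

(** * Relative positions of points, lines, planes and symps *)

Local Notation P := (points M).
Local Notation L := (lines M).
Local Notation Q := (planes M).
Local Notation S := (symps M).
Local Notation polS := symp_polar.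
Local Notation polR := residue_polar.

Definition col : T -> T -> Prop := joined (lines M) on.

Lemma col_sym x y : col x y -> col y x.
Proof. exact: joined_sym. Qed.

Lemma line_col l x y : L l -> pts M l x -> pts M l y -> col x y.
Proof. by move=> Ll xl yl; exists l. Qed.

Lemma plane_symp q : Q q -> exists2 s, S s & q =< s.
Proof. exact: symp_above. Qed.

Lemma line_symp l : L l -> exists2 s, S s & l =< s.
Proof.
move=> Ll; have [q [s [_ Ss lq qs]]] := plane_above Ll.
by exists s => //; apply: subset_trans lq qs.
Qed.

Lemma plane_has_two q s : S s -> Q q -> q =< s -> forall l, L l -> ~ (q =< l).
Proof.
move=> Ss Qq qs l Ll ql.
have [s' Ss' ls] := line_symp Ll.
have qs' := subset_trans ql ls.
have [x xq xl] := plane_off_line (polS Ss') (conj Qq qs') (conj Ll ls).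
exact/xl/ql.
Qed.

(** (MS3) leaves a line or a plane as the intersection, and two points of a plane are joined inside
    it. So non-collinear points are in at most one symp. *)
Lemma symps_meet_line s t x y : S s -> S t -> s <> t -> x <> y ->
  pts M s x -> pts M t x -> pts M s y -> pts M t y ->
  exists l, [/\ L l, pts M l x /\ pts M l y, l =< s & l =< t].
Proof.
move=> Ss St st xy xs xt ys yt.
case: (ms_intersection msM Ss St st) => [e|[p _ e]|[l Ll e]|[q Qq e]].
- by have : (pts M s `&` pts M t) x by []; rewrite e.
- have : (pts M s `&` pts M t) x by []; have : (pts M s `&` pts M t) y by [].
  by rewrite e => /= yp xp; case: xy; rewrite xp yp.
- by exists l; rewrite -e; do !split=> //; move=> z [].
- have qs : q =< s by rewrite -e => z [].
  have xq : pts M q x by rewrite -e.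
  have yq : pts M q y by rewrite -e.
  have [l [Ll ls] [xl yl]] := plane_joined (polS Ss) (conj Qq qs) xq yq.
  have lq := plane_line (polS Ss) (conj Qq qs) (conj Ll ls) xy xq yq xl yl.
  by exists l; split=> // z /lq; rewrite -e => -[].
Qed.

(** A symp [t] on [l] shares with [s] a line through [x] and [y], and in the polar space [t] that
    line is [l]. *)
Lemma line_sub_symp l s x y : L l -> S s -> x <> y -> pts M l x -> pts M l y ->
  pts M s x -> pts M s y -> l =< s.
Proof.
move=> Ll Ss xy xl yl xs ys; have [t St lt] := line_symp Ll.
have [<-//|ts] := pselect (t = s).
have [k [Lk [xk yk] kt ks]] :=
  symps_meet_line St Ss ts xy (lt _ xl) xs (lt _ yl) ys.
by rewrite (line_uniq (polS St) (conj Ll lt) (conj Lk kt) xy).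
Qed.

Lemma line_eq l m x y : L l -> L m -> x <> y -> pts M l x -> pts M l y ->
  pts M m x -> pts M m y -> l = m.
Proof.
move=> Ll Lm xy xl yl xm ym; have [s Ss ls] := line_symp Ll.
have ms := line_sub_symp Lm Ss xy xm ym (ls _ xl) (ls _ yl).
exact: (line_uniq (polS Ss) (conj Ll ls) (conj Lm ms) xy).
Qed.

Lemma symp_joined s x y : S s -> pts M s x -> pts M s y ->
  (joined (fun l => L l /\ l =< s) on x y <-> col x y).
Proof.
move=> Ss xs ys; split=> [[l [Ll _] xy]|[l Ll [xl yl]]]; first by exists l.
have [<-|xy] := pselect (x = y); first exact: (joined_refl (polS Ss)).
by exists l; split=> //; apply: (line_sub_symp Ll Ss xy).
Qed.

Lemma col_refl x s : S s -> pts M s x -> col x x.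
Proof. by move=> Ss xs; apply/(symp_joined Ss xs xs)/(joined_refl (polS Ss)). Qed.

Lemma col_pointl x y : col x y -> P x.
Proof. by case=> l _ [xl _]; apply: pts_point xl. Qed.

Lemma line_third_point l a b : L l -> exists c, [/\ pts M l c, c <> a & c <> b].
Proof.
move=> Ll; have [s Ss ls] := line_symp Ll.
exact: (line_third (polS Ss) a b (conj Ll ls)).
Qed.

Lemma line_other_point l a : L l -> exists2 c, pts M l c & c <> a.
Proof. by move=> Ll; have [c [? ? _]] := line_third_point a a Ll; exists c. Qed.

Lemma plane_col q x y : Q q -> pts M q x -> pts M q y -> col x y.
Proof.
move=> Qq xq yq; have [s Ss qs] := plane_symp Qq.
apply: (symp_joined Ss (qs _ xq) (qs _ yq)).1.
exact: (plane_joined (polS Ss) (conj Qq qs)).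
Qed.

Lemma line_sub_plane q l x y : Q q -> L l -> x <> y -> pts M q x -> pts M q y ->
  pts M l x -> pts M l y -> l =< q.
Proof.
move=> Qq Ll xy xq yq xl yl; have [s Ss qs] := plane_symp Qq.
have ls := line_sub_symp Ll Ss xy xl yl (qs _ xq) (qs _ yq).
exact: (plane_line (polS Ss) (conj Qq qs) (conj Ll ls) xy xq yq xl yl).
Qed.

Lemma plane_lines_meet q l m : Q q -> L l -> L m -> l =< q -> m =< q ->
  exists2 y, pts M l y & pts M m y.
Proof.
move=> Qq Ll Lm lq mq; have [s Ss qs] := plane_symp Qq.
exact: (lines_meet (polS Ss) (conj Qq qs) (conj Ll (subset_trans lq qs))
  (conj Lm (subset_trans mq qs)) lq mq).
Qed.

Lemma plane_point_off q l : Q q -> L l -> exists2 x, pts M q x & ~ pts M l x.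
Proof.
move=> Qq Ll; have [s Ss qs] := plane_symp Qq.
apply: contrapT => H; apply: (plane_has_two Ss Qq qs Ll) => x xq.
by apply: contrapT => xl; apply: H; exists x.
Qed.

Lemma symp_proj s x l : S s -> L l -> l =< s -> pts M s x ->
  exists2 y, pts M l y & col x y.
Proof.
move=> Ss Ll ls xs; have [y yl xy] := joined_proj (polS Ss) xs (conj Ll ls).
by exists y => //; apply/(symp_joined Ss xs (ls _ yl)).
Qed.

Lemma symp_col_line s x l y z w : S s -> L l -> l =< s -> pts M s x ->
  pts M l y -> pts M l z -> y <> z -> col x y -> col x z -> pts M l w -> col x w.
Proof.
move=> Ss Ll ls xs yl zl yz xy xz wl; apply/(symp_joined Ss xs (ls _ wl)).
by apply: (joined_line (polS Ss) xs (conj Ll ls) yl zl yz _ _ wl);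
  apply/symp_joined => //; apply: ls.
Qed.

Lemma symp_plane_max s q x : S s -> Q q -> q =< s -> pts M s x ->
  (forall y, pts M q y -> col x y) -> pts M q x.
Proof.
move=> Ss Qq qs xs H; apply: (plane_max (polS Ss) (conj Qq qs) xs) => y yq.
by apply/(symp_joined Ss xs (qs _ yq))/H.
Qed.

Lemma symp_in_plane s q l c x : S s -> Q q -> q =< s -> L l -> l =< q ->
  pts M q c -> ~ pts M l c -> pts M s x -> (forall y, pts M l y -> col x y) ->
  col x c -> pts M q x.
Proof.
move=> Ss Qq qs Ll lq cq cl xs xl xc; apply: (symp_plane_max Ss) => // y yq.
apply/(symp_joined Ss xs (qs _ yq)).
apply: (plane_joined_all (polS Ss) (conj Qq qs) (conj Ll (subset_trans lq qs)) lq cq cl xs) => //.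
  by move=> z zl; apply/(symp_joined Ss xs (qs _ (lq _ zl)))/xl.
by apply/(symp_joined Ss xs (qs _ cq)).
Qed.

Lemma symp_perp_plane s q x : S s -> Q q -> q =< s -> pts M s x -> ~ pts M q x ->
  exists n, [/\ L n, n =< q & forall y, pts M q y -> (col x y <-> pts M n y)].
Proof.
move=> Ss Qq qs xs xq.
have [n [[Ln _] nq H]] := perp_plane (polS Ss) (conj Qq qs) xs xq.
exists n; split=> // y yq; rewrite -(H y yq); split.
  by move/(symp_joined Ss xs (qs _ yq)).
by move/(symp_joined Ss xs (qs _ yq)).
Qed.

Lemma symp_plane_of_line s l c : S s -> L l -> l =< s -> pts M s c -> ~ pts M l c ->
  (forall y, pts M l y -> col c y) -> exists q, [/\ Q q, q =< s, l =< q & pts M q c].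
Proof.
move=> Ss Ll ls cs cl H.
have [q [[Qq qs] lq cq]] := plane_of_line (polS Ss) (conj Ll ls) cl
  (fun y yl => (symp_joined Ss cs (ls _ yl)).2 (H y yl)).
by exists q.
Qed.

Lemma symp_line_between s x y : S s -> pts M s x -> pts M s y -> col x y ->
  exists l, [/\ L l, l =< s, pts M l x & pts M l y].
Proof.
move=> Ss xs ys /(symp_joined Ss xs ys) [l [Ll ls] [xl yl]].
by exists l.
Qed.

Lemma symp_line_other_plane s l q : S s -> L l -> l =< s ->
  exists q', [/\ Q q', q' =< s, q' <> q & l =< q'].
Proof.
move=> Ss Ll ls; have [q' [[Qq' qs'] ne lq]] := line_other_plane (polS Ss) q (conj Ll ls).
by exists q'.
Qed.

Lemma plane_sub_plane q q' : Q q -> Q q' -> q =< q' -> q = q'.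
Proof.
move=> Qq Qq' qq'; have [s Ss qs'] := plane_symp Qq'.
exact: (plane_sub_eq (polS Ss) (conj Qq (subset_trans qq' qs')) (conj Qq' qs') qq').
Qed.

Lemma symps_meet_plane s t q : S s -> S t -> s <> t -> Q q -> q =< s -> q =< t ->
  forall x, pts M s x -> pts M t x -> pts M q x.
Proof.
move=> Ss St st Qq qs qt.
have qst : pts M q `<=` pts M s `&` pts M t by move=> y yq; split; auto.
have [ne _ _] := ms_geometry msM.
have [l Ll] : exists l, L l by apply: (ne (@Ordinal 4 1 isT)).
case: (ms_intersection msM Ss St st) => [e|[p _ e]|[k Lk e]|[r Qr e]].
- by case: (plane_has_two Ss Qq qs Ll) => y /qst; rewrite e.
- have [a aq _] := plane_point_off Qq Ll.
  have [k Lk [ak _]] := plane_col Qq aq aq.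
  have [b bq bk] := plane_point_off Qq Lk; case: bk.
  by have := qst _ aq; have := qst _ bq; rewrite e /= => -> <-.
- by case: (plane_has_two Ss Qq qs Lk) => y /qst; rewrite e.
- have qr : q =< r by rewrite -e.
  by rewrite (plane_sub_plane Qq Qr qr) -e.
Qed.

Lemma plane_other_symp q s : Q q -> exists t, [/\ S t, q =< t & t <> s].
Proof.
move=> Qq; have [ne _ _] := ms_geometry msM.
have [l Ll] : exists l, L l by apply: (ne (@Ordinal 4 1 isT)).
have [a aq _] := plane_point_off Qq Ll.
have [t [[St qt] ts _]] := line_third (polR (pts_point aq)) s s (conj Qq aq).
by exists t.
Qed.

(** A plane is the intersection of two symps on it. This brings containments found in a residue back
    to point sets. *)
Lemma sub_plane_of_symps q u : Q q -> (forall t, S t -> q =< t -> u =< t) -> u =< q.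
Proof.
move=> Qq H; have [s Ss qs] := plane_symp Qq.
have [t [St qt ts]] := plane_other_symp s Qq.
by move=> x xu; apply: (symps_meet_plane St Ss ts Qq qt qs); apply: H xu.
Qed.

Lemma line_point_ex l : L l -> exists x, pts M l x.
Proof. by move=> Ll; have [x xl _] := line_other_point l Ll; exists x. Qed.

(** In the residue of a point of [l], the symps are points of the plane [l], hence joined. *)
Lemma symps_on_line s t l : S s -> S t -> s <> t -> L l -> l =< s -> l =< t ->
  exists q, [/\ Q q, l =< q, q =< s, q =< t &
    forall x, pts M s x -> pts M t x -> pts M q x].
Proof.
move=> Ss St st Ll ls lt; have [p pl] := line_point_ex Ll.
have [q [Qq pq] [[_ qs] [_ qt]]] :=
  plane_joined (polR (pts_point pl)) (conj Ll pl) (conj Ss ls) (conj St lt).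
have H := symps_meet_plane Ss St st Qq qs qt.
by exists q; split=> // x xl; apply: H; [apply: ls|apply: lt].
Qed.

(** In the residue of a point of [l], [q] and [r] are lines of the plane [l], hence they meet. *)
Lemma planes_on_line q r l : Q q -> Q r -> L l -> l =< q -> l =< r ->
  exists s, [/\ S s, q =< s & r =< s].
Proof.
move=> Qq Qr Ll lq lr; have [p pl] := line_point_ex Ll.
have wi r' : l =< r' -> within (through) r' l.
  by move=> lr' s [Ss rs]; split=> //; apply: subset_trans lr' rs.
have [s [Ss qs] [_ rs]] := lines_meet (polR (pts_point pl)) (conj Ll pl)
  (conj Qq (lq _ pl)) (conj Qr (lr _ pl)) (wi _ lq) (wi _ lr).
by exists s.
Qed.

(** In the residue of [a], the line [l] from [p] to [a] is a plane missing the point [s]. The points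
    of that plane joined to [s] form a line, which is [q]; the plane spanned by [s] and [q] is
    [n]. *)
Lemma perp_symp_line p a s : S s -> pts M s a -> ~ pts M s p -> col p a ->
  exists q n, [/\ Q q, L n, pts M q p, pts M n a & n =< q /\ n =< s].
Proof.
move=> Ss sa sp [l Ll [pl al]]; have Pa := pts_point al.
have sl : ~ through s l by case=> _ /(_ p pl).
have [q [[Qq aq] ql H]] := perp_plane (polR Pa) (conj Ll al) (conj Ss sa) sl.
have lq : l =< q by apply: sub_plane_of_symps => // t St qt; case: (ql t (conj St qt)).
have sq : ~ through s q by case=> _ qs; apply/sp/qs/lq.
have [n [[Ln an] qn [_ ns]]] := plane_of_line (polR Pa) (conj Qq aq) sq
  (fun t tq => (H t (ql t tq)).2 tq).
exists q, n; split=> //; first exact: lq.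
by split=> //; apply: sub_plane_of_symps => // t St qt; case: (qn t (conj St qt)).
Qed.

Lemma plane_sub_symp q l c s : Q q -> L l -> S s -> l =< q -> pts M q c ->
  ~ pts M l c -> l =< s -> pts M s c -> q =< s.
Proof.
move=> Qq Ll Ss lq cq cl ls sc z zq.
have [m Lm [zm cm]] := plane_col Qq zq cq.
have [<-//|ze] := pselect (c = z).
have mq := line_sub_plane Qq Lm ze cq zq cm zm.
have [w wm wl] := plane_lines_meet Qq Lm Ll mq lq.
have cw : c <> w by move=> E; apply: cl; rewrite E.
by apply: (line_sub_symp Lm Ss cw cm wm sc (ls _ wl)).
Qed.

Lemma line_point_symp s q l e : S s -> Q q -> L l -> l =< q -> l =< s ->
  pts M s e -> ~ pts M l e -> (forall y, pts M l y -> col e y) ->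
  exists t, [/\ S t, q =< t & pts M t e].
Proof.
move=> Ss Qq Ll lq ls se le H.
have [r0 [Qr rs lr er]] := symp_plane_of_line Ss Ll ls se le H.
have [t [St qt rt]] := planes_on_line Qq Qr Ll lq lr.
by exists t; split=> //; apply: rt.
Qed.

(* Otherwise e would be in the plane q of t, and then q, being spanned by l and
   e, would be contained in s. *)
Lemma not_col_of_symp s t p q l e : S s -> S t -> ~ pts M s p -> Q q -> L l ->
  pts M q p -> l =< q -> l =< s -> q =< t -> pts M s e -> pts M t e ->
  ~ pts M l e -> (forall y, pts M l y -> col e y) -> ~ col p e.
Proof.
move=> Ss St sp Qq Ll pq lq ls qt se te le H pe.
have pl : ~ pts M l p by move=> /ls.
have eq : pts M q e.
  by apply: (symp_in_plane St Qq qt Ll lq pq pl te H); apply: col_sym.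
exact/sp/(plane_sub_symp Qq Ll Ss lq eq le ls se).
Qed.

(** If [a] and [b] were not collinear, planes on [p] would meet [s] in lines [na] on [a] and [nb] on
    [b]. Take [e] in [s] off both lines and collinear to both, and symps [ta], [tb] on [e] and these
    planes. If they are equal, they share [a] and [b] with [s] and are [s], although [p] is not in
    [s]; if not, [p] and [e] are collinear, against [not_col_of_symp]. *)
Lemma perp_symp_clique p s a b : S s -> ~ pts M s p -> pts M s a -> pts M s b ->
  col p a -> col p b -> col a b.
Proof.
move=> Ss sp sa sb pa pb.
have [qa [na [Qa La pqa ana [naq nas]]]] := perp_symp_line Ss sa sp pa.
have [qb [nb [Qb Lb pqb bnb [nbq nbs]]]] := perp_symp_line Ss sb sp pb.
apply: contrapT => nab.
have nabs : ~ joined (fun l => L l /\ l =< s) on a b by move/(symp_joined Ss sa sb).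
have [e [se ea eb Ha Hb]] := common_neighbour_off_lines (polS Ss)
  (conj La nas) (conj Lb nbs) ana bnb nabs.
have Ca y : pts M na y -> col e y by move=> yn; apply/(symp_joined Ss se (nas _ yn))/Ha.
have Cb y : pts M nb y -> col e y by move=> yn; apply/(symp_joined Ss se (nbs _ yn))/Hb.
have [ta [Sta qta eta]] := line_point_symp Ss Qa La naq nas se ea Ca.
have [tb [Stb qtb etb]] := line_point_symp Ss Qb Lb nbq nbs se eb Cb.
have npe := not_col_of_symp Ss Sta sp Qa La pqa naq nas qta se eta ea Ca.
have [E|ne] := pselect (ta = tb).
  have st : s <> ta by move=> E'; apply: sp; rewrite E'; apply: qta.
  have ta_b : pts M ta b by rewrite E; apply/qtb/nbq.
  have ta_a : pts M ta a by apply/qta/naq.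
  have ab : a <> b by move=> ab; apply: nab; rewrite ab; apply: col_refl sb.
  have [l [Ll [al bl] _ _]] := symps_meet_line Ss Sta st ab sa ta_a sb ta_b.
  by apply: nab; exists l.
have pe : p <> e by move=> E; apply: sp; rewrite E.
have [l [Ll [pl el] _ _]] := symps_meet_line Sta Stb ne pe (qta _ pqa) (qtb _ pqb) eta etb.
by apply: npe; exists l.
Qed.

(** A neighbour [b] of [p] in [s] off [n] would be collinear to all of [n] by [perp_symp_clique].
    The planes spanned by [n] with [b] and with [p] would then be in one symp, against
    [not_col_of_symp]. *)
Lemma perp_symp p a s : S s -> pts M s a -> ~ pts M s p -> col p a ->
  exists q n, [/\ Q q, L n, pts M q p & [/\ n =< q, n =< s &
    forall y, pts M s y -> (col p y <-> pts M n y)]].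
Proof.
move=> Ss sa sp pa.
have [q [n [Qq Ln pq an [nq ns]]]] := perp_symp_line Ss sa sp pa.
exists q, n; split=> //; split=> // b sb; split=> [pb|bn]; last first.
  exact/(plane_col Qq pq)/nq.
apply: contrapT => bn.
have pn y : pts M n y -> col p y by move=> yn; exact/(plane_col Qq pq)/nq.
have bnc y : pts M n y -> col b y.
  by move=> yn; apply: (perp_symp_clique Ss sp sb (ns _ yn) pb (pn _ yn)).
have [r [Qr rs nr br]] := symp_plane_of_line Ss Ln ns sb bn bnc.
have [t [St qt rt]] := planes_on_line Qq Qr Ln nq nr.
exact: (not_col_of_symp Ss St sp Qq Ln pq nq ns qt sb (rt _ br) bn bnc pb).
Qed.

Lemma symp_eq s t a b : S s -> S t -> pts M s a -> pts M s b -> pts M t a ->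
  pts M t b -> ~ col a b -> s = t.
Proof.
move=> Ss St sa sb ta tb nab; apply: contrapT => st.
have ab : a <> b by move=> ab; apply: nab; rewrite ab; apply: col_refl sb.
have [l [Ll [al bl] _ _]] := symps_meet_line Ss St st ab sa ta sb tb.
by apply: nab; exists l.
Qed.

(** The residue of [p] has on its line [q] a point [t] joined to its point [s]; [t] may be [s]
    itself. *)
Lemma residue_proj p s q : S s -> pts M s p -> Q q -> pts M q p ->
  exists t r, [/\ S t, q =< t, Q r, pts M r p & r =< s /\ r =< t].
Proof.
move=> Ss sp Qq qp.
have [t [St qt] [r [Qr rp] [[_ rs] [_ rt]]]] :=
  joined_proj (polR (pts_point qp)) (conj Ss sp) (conj Qq qp).
by exists t, r.
Qed.

(** Non-degeneracy of the residue of [p]: a second common point would give a common line, hence a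
    common plane on [p]. *)
Lemma symp_meeting_in_point p s : S s -> pts M s p -> exists t,
  [/\ S t, pts M t p & forall x, pts M s x -> pts M t x -> x = p].
Proof.
move=> Ss sp; have [t [St tp] nst] := not_joined (polR (pts_point sp)) (conj Ss sp).
exists t; split=> // x sx tx; apply: contrapT => xp; apply: nst.
have [<-|st] := pselect (s = t); first exact: (joined_refl (polR (pts_point sp))).
have [l [Ll [_ pl] ls lt]] := symps_meet_line Ss St st xp sx tx sp tp.
have [q [Qq lq qs qt _]] := symps_on_line Ss St st Ll ls lt.
by exists q; split=> //; apply: lq.
Qed.

Lemma symp_plane_at p s : S s -> pts M s p -> exists q, [/\ Q q, pts M q p & q =< s].
Proof.
move=> Ss sp; have [l [Ll ls] [pl _]] := joined_refl (polS Ss) sp.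
have [q [Qq qs] lq] := line_plane (polS Ss) (conj Ll ls).
by exists q; split=> //; apply: lq.
Qed.

Lemma line_sub_eq m n : L m -> L n -> m =< n -> m = n.
Proof.
move=> Lm Ln mn; have [x xm] := line_point_ex Lm.
have [y ym yx] := line_other_point x Lm.
by apply: (line_eq Lm Ln yx) => //; apply: mn.
Qed.

Lemma collinearE x y : P x -> P y -> (collinear M x y <-> col x y).
Proof.
move=> Px Py; split=> -[l Ll [xl yl]]; exists l => //.
  by split; split=> //; right.
have inc z : pts M l z -> incident M z l.
  move=> [Pz [zl|//]]; rewrite -zl in Ll.
  by have := geometry_disjoint (ms_geometry msM) Pz Ll.
by split; apply: inc.
Qed.

Lemma adjacent_sympsP s t : S s -> S t -> adjacent_symps M s t <->
  s <> t /\ exists q, [/\ Q q, q =< s & q =< t].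
Proof.
move=> Ss St; split=> [[st [q Qq e]]|[st [q [Qq qs qt]]]].
  by split=> //; exists q; split=> // x; rewrite -e => -[].
split=> //; exists q => //; apply/seteqP; split=> x.
  by case; apply: symps_meet_plane.
by move=> xq; split; auto.
Qed.

(** The symps [s] and [r] share a line on [w] and [n0], hence a plane [q]. Inside [r], the points of
    [q] collinear to [x] form a line; it is contained in [n], so it is [n]. *)
Lemma perp_line_plane s r x w n0 n : S s -> S r -> ~ pts M s x -> pts M r x ->
  pts M r w -> pts M s w -> pts M r n0 -> pts M s n0 -> w <> n0 ->
  ~ col x w -> L n -> (forall y, pts M s y -> (col x y <-> pts M n y)) ->
  exists q, [/\ Q q, n =< q, q =< r, q =< s & pts M q w].
Proof.
move=> Ss Sr sx rx rw sw rn sn wn nxw Ln H.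
have ne : s <> r by move=> e; apply: sx; rewrite e.
have [l [Ll [wl _] ls lr]] := symps_meet_line Ss Sr ne wn sw rw sn rn.
have [q [Qq lq qs qr _]] := symps_on_line Ss Sr ne Ll ls lr.
have xq : ~ pts M q x by move=> /qs.
have [m [Lm mq Hm]] := symp_perp_plane Sr Qq qr rx xq.
suff <- : m = n by exists q; split=> //; apply: lq.
apply: line_sub_eq => // y ym; apply/H; first exact/qs/mq.
by apply/Hm => //; apply: mq.
Qed.

(** * Embedded octagons *)

Section Octagon.
Variable O : geometry T 2.
Hypotheses (octO : generalised_octagon O) (embO : fully_embedded O M).

Local Notation OP := (points O).
Local Notation OL := (lines O).
Let gO : is_geometry O := let: And4 g _ _ _ := octO in g.

(** Collinearity in the octagon, reflexive on its points. It uses the point sets of [M], which agree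
    with incidence in [O] on octagon lines. *)
Definition ocol (x y : T) : Prop := joined OL (fun x l => pts M l x) x y.

Lemma oline l : OL l -> lines M l.
Proof. by have [_ H _ _] := embO; apply: H. Qed.

Lemma opoint x : OP x -> points M x.
Proof. by have [H _ _ _] := embO; apply: H. Qed.

Lemma oline_point l x : OL l -> pts M l x -> OP x.
Proof. by have [_ _ _ H] := embO; move=> /H; apply. Qed.

Lemma ocol_pointl x y : ocol x y -> OP x.
Proof. by case=> l Ol [xl _]; apply: (oline_point Ol xl). Qed.

Lemma ocol_sym x y : ocol x y -> ocol y x.
Proof. exact: joined_sym. Qed.

Lemma ocol_pointr x y : ocol x y -> OP y.
Proof. by move/ocol_sym/ocol_pointl. Qed.

Lemma ocol_col x y : ocol x y -> col x y.
Proof. by case=> l /oline Ll xy; exists l. Qed.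

Lemma oincident_line x l : OL l -> incident O x l <-> pts M l x.
Proof.
move=> Ol; have Ll := oline Ol; have [_ _ inc _] := embO.
have E : OP x -> (incident O x l <-> pts M l x).
  move=> Ox; rewrite (inc x l Ox Ol); split=> [xl|[Px [xl|//]]].
    by split; [apply: opoint|right].
  rewrite xl in Px; by have := geometry_disjoint (ms_geometry msM) Px Ll.
split=> [xl|xl]; last by apply/E => //; apply: oline_point xl.
apply/E => //; case: xl => c [i [j [Cc ij ci cj]]]; have [_ _ ch] := gO.
have ei := ch _ Cc i; have ej := ch _ Cc j; rewrite ci in ei; rewrite cj in ej.
have ej1 := geometry_disjoint gO ej Ol.
case: i ij ei {ci} => -[|[|//]] lti ij ei; last first.
  by move/negP: ij; case; rewrite ej1; apply/eqP/val_inj.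
by rewrite /points (_ : Ordinal _ = Ordinal lti) //; apply/val_inj.
Qed.

Lemma oincidentP u v : incident O u v <->
  (OL v /\ pts M v u) \/ (OL u /\ pts M u v).
Proof.
split=> [uv|[[Ov vu]|[Ou uv]]]; last 2 first.
- exact/oincident_line.
- exact/incident_sym/oincident_line.
have [c [i [j [Cc ij ci cj]]]] := uv; have [_ _ ch] := gO.
have ei := ch _ Cc i; have ej := ch _ Cc j; rewrite ci in ei; rewrite cj in ej.
have line k w : element O k w -> val k = 1 -> OL w.
  by move=> kw k1; rewrite /lines (_ : Ordinal _ = k) //; apply/val_inj.
case: j ij ej {cj} => -[|[|//]] ltj ij ej; last first.
  by left; have Ov := line _ _ ej erefl; split=> //; apply/oincident_line.
case: i ij ei {ci} => -[|[|//]] lti ij ei.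
  by move/negP: ij; case; apply/eqP/val_inj.
by right; have Ou := line _ _ ei erefl; split=> //; apply/oincident_line/incident_sym.
Qed.

Lemma ocollinearE x y : collinear O x y <-> ocol x y.
Proof.
by split=> -[l Ol [xl yl]]; exists l => //; split; apply/oincident_line.
Qed.

(** Circuits have at least 16 vertices. The lemma is applied to closed walks, where equal ends are
    the contradiction. *)
Lemma owalk_injective n (f : nat -> T) : (n < 16)%N ->
  (forall i, (i < n)%N -> incident O (f i) (f i.+1)) ->
  (forall i, (i.+1 < n)%N -> f i <> f i.+2) ->
  forall i j, (i < j <= n)%N -> f i <> f j.
Proof.
move=> n16; apply: nonbacktracking_injective.
  by move=> x xx; apply: (incident_neq gO xx).
move=> k kn /(fun c => let: And4 _ _ (conj _ H) _ := octO in H k c).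
by rewrite leqNgt (leq_ltn_trans kn n16).
Qed.

(** Otherwise [y], [k], [u], [l], [v], [k'], [y] is a closed walk of 6 incidences without
    backtracking. *)
Lemma otriangle y l u v : OL l -> pts M l u -> pts M l v -> u <> v ->
  ocol y u -> ocol y v -> pts M l y.
Proof.
move=> Ol ul vl uv [k Ok [yk uk]] [k' Ok' [yk' vk']].
apply: contrapT => yl.
have kl : k <> l by move=> e; apply: yl; rewrite -e.
have kl' : l <> k' by move=> e; apply: yl; rewrite e.
have yu : y <> u by move=> e; apply: yl; rewrite e.
have yv : v <> y by move=> e; apply: yl; rewrite -e.
pose f := nth y [:: y; k; u; l; v; k'; y].
apply: (@owalk_injective 6 f _ _ _ 0 6) => //.
  by case=> [|[|[|[|[|[|//]]]]]] _; apply/oincidentP; rewrite /f /=; tauto.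
by case=> [|[|[|[|[|//]]]]] _; rewrite /f /=.
Qed.

Local Notation cg := (collinearity_graph O).

Lemma cgE x y : cg x y <-> x <> y /\ ocol x y.
Proof.
split=> [[_ _ xy /ocollinearE]|[xy c]]; first by [].
by split=> //; [apply: ocol_pointl c|apply: ocol_pointr c|apply/ocollinearE].
Qed.

(** Two incidences lead from a point to a point and make at most one step in the collinearity graph.
    So diameter 8 becomes distance at most 4. *)
Lemma incident_walk k x y : OP x -> OP y -> walk (incident O) k x y ->
  exists2 m, (m.*2 <= k)%N & walk cg m x y.
Proof.
elim/ltn_ind: k x => -[|[|k]] IH x Ox Oy.
- by move=> /= ->; exists 0.
- move=> /= [w /oincidentP xw wy]; rewrite wy in xw.
  case: xw => [[Oy' _]|[Ox' _]].
    by have := geometry_disjoint gO Oy Oy'.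
  by have := geometry_disjoint gO Ox Ox'.
move=> [l /oincidentP xl [z /oincidentP lz wzy]].
have {xl} [Ol xl] : OL l /\ pts M l x.
  case: xl => // -[Ox' _]; by have := geometry_disjoint gO Ox Ox'.
have {lz} zl : pts M l z.
  case: lz => [[_ lz]|[_ //]].
  by have := geometry_disjoint (ms_geometry msM) (pts_point lz) (oline Ol).
have [m mk wm] := IH k (ltnW (ltnSn _)) z (oline_point Ol zl) Oy wzy.
have [xz|xz] := pselect (x = z).
  by rewrite xz; exists m => //; rewrite (leq_trans mk) // -addn2 leq_addr.
exists m.+1; first by rewrite doubleS !ltnS.
by exists z => //; apply/cgE; split=> //; exists l.
Qed.

Lemma odist_ex x y : OP x -> OP y -> x <> y ->
  exists d, [/\ (0 < d)%N, (d <= 4)%N & octagon_dist O x y d].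
Proof.
move=> Ox Oy xy; have [_ [diam _] _ _] := octO.
have [k k8 w] := diam x y (ex_intro _ (@Ordinal 2 0 isT) Ox) (ex_intro _ (@Ordinal 2 0 isT) Oy).
have [m mk wm] := incident_walk Ox Oy w.
have [d dm gd] := walk_dist wm; exists d; split=> //.
  by case: d gd {dm} => // -[].
by apply: leq_trans dm _; rewrite -leq_double (leq_trans mk).
Qed.

Lemma odist_sym x y d : octagon_dist O x y d -> octagon_dist O y x d.
Proof.
have cs u v : cg u v -> cg v u.
  by move=> /cgE [uv c]; apply/cgE; split; [exact: not_eq_sym|exact: ocol_sym].
move=> [w H]; split; first exact: walk_sym w.
by move=> k kd wk; apply: (H k kd); apply: walk_sym wk.
Qed.

Lemma odist1P x y : octagon_dist O x y 1 <-> x <> y /\ ocol x y.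
Proof.
split=> [[[z xz <-] _]|xy]; first exact/cgE.
split; first by exists y => //; apply/cgE.
by case=> // _ /= e; case: xy.
Qed.

Lemma odist2P x y : octagon_dist O x y 2 -> exists z,
  [/\ z <> x, z <> y, ocol x z & ocol z y].
Proof.
case=> -[z /cgE [xz cxz]] [w /cgE[zw czw] <-] _.
by exists z; split=> // /esym.
Qed.

Lemma odist2_intro x y z : ocol x z -> ocol z y -> ~ ocol x y ->
  octagon_dist O x y 2.
Proof.
move=> xz zy nxy.
have xz' : x <> z by move=> e; apply: nxy; rewrite e.
have zy' : z <> y by move=> e; apply: nxy; rewrite -e.
split; first by exists z; [apply/cgE|exists y => //; apply/cgE].
case=> [_ /= e|[_ /= [w /cgE [_ xw] e]|//]]; last by apply: nxy; rewrite -e.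
apply: nxy; rewrite -e; case: xz => l Ol [xl _]; by exists l.
Qed.

Lemma odist3P x y : octagon_dist O x y 3 -> exists a b,
  [/\ ocol x a, ocol a b, ocol b y, octagon_dist O x b 2 & octagon_dist O a y 2].
Proof.
case=> -[a xa [b ab [c bc e]]] H; rewrite /= in e; rewrite e in bc.
have cc u v : cg u v -> ocol u v by case/cgE.
exists a, b; split; do ?exact: cc; split=> /=.
- by exists a => //; exists b.
- case=> [_ /= E|[_ /= [w xw E]|//]].
    by apply: (H 1) => //; exists y => //; rewrite E.
  by apply: (H 2) => //; exists b; [rewrite -E|exists y].
- by exists b => //; exists y.
- case=> [_ /= E|[_ /= [w aw E]|//]].
    by apply: (H 1) => //; exists y => //; rewrite -E.
  by apply: (H 2) => //; exists a => //; exists y => //; rewrite -E.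
Qed.

Lemma odist_uniq x y d d' : octagon_dist O x y d -> octagon_dist O x y d' -> d = d'.
Proof.
case=> w H [w' H']; case: (ltngtP d d') => // lt.
  by case: (H' _ lt w).
by case: (H _ lt w').
Qed.

(* If all points of [l] were at distance 3 from [w], then two of the geodesics
   would close up to a circuit of length at most 14 in the incidence graph. *)
Lemma nearest_point w l : OP w -> OL l ->
  (forall v, pts M l v -> octagon_dist O w v 2 \/ octagon_dist O w v 3) ->
  exists u z, [/\ pts M l u, ocol u z, ocol z w & forall v, pts M l v -> v <> u ->
    [/\ octagon_dist O v w 3, octagon_dist O v z 2 & octagon_dist O u w 2]].
Proof.
move=> Ow Ol H.
have no2 x y : octagon_dist O x y 2 -> ~ ocol x y.
  move=> d2 c; have [e|xy] := pselect (x = y).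
    by case: d2 => _ /(_ 0 isT).
  by have := odist_uniq d2 ((odist1P x y).2 (conj xy c)).
have off x : ocol w x -> ~ pts M l x.
  move=> wx xl; have [d2|d3] := H x xl; first exact: no2 d2 wx.
  have [e|wx'] := pselect (w = x); first by case: d3 => _ /(_ 0 isT).
  by have := odist_uniq d3 ((odist1P w x).2 (conj wx' wx)).
have line_ne x y z m m' : pts M m x -> pts M m y -> OL m -> pts M m' y ->
    pts M m' z -> octagon_dist O x z 2 -> m <> m'.
  by move=> xm _ Om _ zm d e; apply: (no2 _ _ d); exists m => //; split=> //; rewrite e.
have [[u ul d2]|no] := pselect (exists2 u, pts M l u & octagon_dist O w u 2).
  have [z [zw zu wz cz]] := odist2P d2; have zl := off z wz.
  exists u, z; split; [by []|exact: ocol_sym|exact: ocol_sym|].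
  move=> v vl vu; split; last exact: odist_sym.
    (* A second point of [l] at distance 2 from [w] would close up to a walk of 10 incidences. *)
    apply: odist_sym; have [d2'|//] := H v vl; exfalso.
    have [z' [zw' zv' wz' cz']] := odist2P d2'; have zl' := off z' wz'.
    have [l1 O1 [w1 z1]] := wz; have [l2 O2 [z2 u2]] := cz.
    have [l4 O4 [w4 z4]] := wz'; have [l3 O3 [z3 v3]] := cz'.
    have n12 : l1 <> l2 := line_ne _ _ _ _ _ w1 z1 O1 z2 u2 d2.
    have n43 : l4 <> l3 := line_ne _ _ _ _ _ w4 z4 O4 z3 v3 d2'.
    have n2 : l2 <> l by move=> e; apply: zl; rewrite -e.
    have n3 : l <> l3 by move=> e; apply: zl'; rewrite e.
    pose f := nth w [:: w; l1; z; l2; u; l; v; l3; z'; l4; w].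
    apply: (@owalk_injective 10 f _ _ _ 0 10) => //.
      by case=> [|[|[|[|[|[|[|[|[|[|//]]]]]]]]]] _; apply/oincidentP; first [by left | by right].
    by case=> [|[|[|[|[|[|[|[|[|//]]]]]]]]] _; rewrite /f /=; by [|apply: not_eq_sym].
  apply: (@odist2_intro v z u); [by exists l|exact: ocol_sym|].
  by move=> vz; apply/zl/(otriangle Ol ul vl (not_eq_sym vu)); [|exact: ocol_sym].
have {no} H3 v : pts M l v -> octagon_dist O w v 3.
  by move=> vl; have [d2|//] := H v vl; case: no; exists v.
have path3 v : pts M l v -> exists a b m1 m2 m3,
    [/\ [/\ OL m1, OL m2 & OL m3], [/\ pts M m1 w, pts M m1 a & pts M m2 a],
        [/\ pts M m2 b, pts M m3 b & pts M m3 v],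
        [/\ w <> a, a <> b & b <> v] & [/\ m1 <> m2, m2 <> m3 & m3 <> l]].
  move=> vl; have [a [b [wa ab bv db da]]] := odist3P (H3 v vl).
  have [m1 O1 [w1 a1]] := wa; have [m2 O2 [a2 b2]] := ab; have [m3 O3 [b3 v3]] := bv.
  exists a, b, m1, m2, m3; split=> //.
    split=> e.
    - by apply: (no2 _ _ db); rewrite e.
    - by apply: (no2 _ _ da); rewrite e.
    - by apply: (no2 _ _ da); rewrite -e.
  split; first exact: (line_ne _ _ _ _ _ w1 a1 O1 a2 b2 db).
    exact: (line_ne _ _ _ _ _ a2 b2 O2 b3 v3 da).
  move=> e; rewrite e in b3.
  by have := odist_uniq db (H3 b b3).
have [u [v [ul vl uv]]] : exists u v, [/\ pts M l u, pts M l v & u <> v].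
  have [u ul] := line_point_ex (oline Ol).
  by have [v vl vu] := line_other_point u (oline Ol); exists u, v; split=> // /esym.
exfalso; have [a [b [m1 [m2 [m3 [[O1 O2 O3] [w1 a1 a2] [b2 b3 u3] [wa ab bu] [n1 n2 n3]]]]]]] := path3 u ul.
have [a' [b' [k1 [k2 [k3 [[Q1 Q2 Q3] [w1' a1' a2'] [b2' b3' v3] [wa' ab' bv'] [k12 k23 k3l]]]]]]] := path3 v vl.
pose f := nth w [:: w; m1; a; m2; b; m3; u; l; v; k3; b'; k2; a'; k1; w].
apply: (@owalk_injective 14 f _ _ _ 0 14) => //.
  by case=> [|[|[|[|[|[|[|[|[|[|[|[|[|[|//]]]]]]]]]]]]]] _; apply/oincidentP; first [by left | by right].
by case=> [|[|[|[|[|[|[|[|[|[|[|[|[|//]]]]]]]]]]]]] _; rewrite /f /=; by [|apply: not_eq_sym].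
Qed.

(** * Polarised embeddings *)

Section Polarised.
Variable th : T -> T.
Hypotheses (psO : pseudo_isometric O M) (spO : strongly_polarised O M)
  (polth : forall x, points O x -> polarising_symp O M x (th x)).

Local Notation dist := (octagon_dist O).
Local Notation Obar := (dual_octagon O M th).

Lemma th_symp x : OP x -> S (th x).
Proof. by case/polth. Qed.

Lemma th_self x : OP x -> pts M (th x) x.
Proof. by case/polth. Qed.

Lemma th_ocol x y : ocol x y -> pts M (th x) y.
Proof.
move=> xy; have [_ _ H] := polth (ocol_pointl xy).
apply: H; first exact: (ocol_pointr xy).
exact/ocollinearE.
Qed.

Lemma th_oline l x : OL l -> pts M l x -> l =< th x.
Proof. by move=> Ol xl y yl; apply: th_ocol; exists l. Qed.

Lemma th_rel x y : OP x -> OP y -> x <> y ->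
  [/\ collinear M x y <-> adjacent_symps M (th x) (th y),
      symplectic_points M x y <-> symplectic_symps M (th x) (th y),
      special_points M x y <-> special_symps M (th x) (th y)
    & opposite_points M x y <-> opposite_symps M (th x) (th y)].
Proof. by move=> Ox Oy xy; apply: spO.2 => //; apply: polth. Qed.

Lemma th_adjacent x y : ocol x y -> x <> y -> th x <> th y /\
  exists q, [/\ Q q, q =< th x & q =< th y].
Proof.
move=> c xy; have Ox := ocol_pointl c; have Oy := ocol_pointr c.
apply/(adjacent_sympsP (th_symp Ox) (th_symp Oy)).
have [[H _] _ _ _] := th_rel Ox Oy xy; apply/H.
exact/(collinearE (opoint Ox) (opoint Oy))/(ocol_col c).
Qed.

Lemma dist2_neq x y : dist x y 2 -> x <> y.
Proof. by case=> _ /(_ 0 isT). Qed.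

Lemma dist2_points x y : dist x y 2 -> OP x /\ OP y.
Proof.
move=> /odist2P [z [_ _ xz zy]].
by split; [exact: (ocol_pointl xz)|exact: (ocol_pointr zy)].
Qed.

Lemma dist2_symplectic x y : dist x y 2 -> symplectic_points M x y.
Proof.
move=> d; have [Ox Oy] := dist2_points d.
by have [_ [H _] _ _] := psO Ox Oy (dist2_neq d); apply: H.
Qed.

Lemma dist2_not_col x y : dist x y 2 -> ~ col x y.
Proof.
move=> d; have [Ox Oy] := dist2_points d; have [H _] := dist2_symplectic d.
by move/(collinearE (opoint Ox) (opoint Oy)).
Qed.

Lemma th_dist2 x y z p : dist x y 2 -> ocol x z -> ocol z y ->
  pts M (th x) p -> pts M (th y) p -> p = z.
Proof.
move=> d xz zy px py; have [Ox Oy] := dist2_points d.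
have [_ [H _] _ _] := th_rel Ox Oy (dist2_neq d).
have [_ [p0 _ e]] := H (dist2_symplectic d).
have : (pts M (th x) `&` pts M (th y)) p by [].
have : (pts M (th x) `&` pts M (th y)) z.
  by split; apply: th_ocol => //; apply: ocol_sym.
by rewrite e /= => -> ->.
Qed.

(** Non-collinear points in a common symp are symplectic. *)
Lemma common_symp x y s : OP x -> OP y -> x <> y -> S s -> pts M s x -> pts M s y ->
  ocol x y \/ dist x y 2.
Proof.
move=> Ox Oy xy Ss sx sy; have [[_ d1] [_ d2] _ _] := psO Ox Oy xy.
have [c|nc] := pselect (collinear M x y).
  by left; case: ((odist1P x y).1 (d1 c)).
right; apply: d2; split=> //; exists s; split=> // t [St tx ty].
apply: (symp_eq Ss St sx sy tx ty) => c; apply: nc.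
exact/(collinearE (opoint Ox) (opoint Oy)).
Qed.

Lemma dist2_symp x y z s : dist x y 2 -> ocol x z -> ocol z y -> S s ->
  pts M s x -> pts M s y -> s = th z.
Proof.
move=> d xz zy Ss sx sy.
apply: (symp_eq Ss (th_symp (ocol_pointr xz)) sx sy).
- exact/th_ocol/ocol_sym.
- exact: th_ocol.
- exact: dist2_not_col.
Qed.

(** If [y] were at distance 2 from [x], with [z] between them, then [th x] and [th z] would be the
    unique symp on [x] and [y], but they are distinct. *)
Lemma point_in_th x y : OP x -> OP y -> pts M (th x) y -> y = x \/ ocol x y.
Proof.
move=> Ox Oy xy; have [e|ne] := pselect (y = x); first by left.
right; have [//|d] := common_symp Ox Oy (not_eq_sym ne) (th_symp Ox) (th_self Ox) xy.
have [z [zx _ xz zy]] := odist2P d.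
have e := dist2_symp d xz zy (th_symp Ox) (th_self Ox) xy.
by have [] := th_adjacent xz (not_eq_sym zx).
Qed.

Lemma th_inj x y : OP x -> OP y -> th x = th y -> x = y.
Proof.
move=> Ox Oy e; apply: contrapT => xy.
have [|//|c] := point_in_th Ox Oy; first by rewrite e; apply: th_self.
  by move/esym.
by have [] := th_adjacent c xy.
Qed.

Lemma oline_in_th l y : OP y -> OL l -> l =< th y -> pts M l y.
Proof.
move=> Oy Ol ly; apply: contrapT => yl; have Ll := oline Ol.
have [u ul] := line_point_ex Ll; have [v vl vu] := line_other_point u Ll.
have H w : pts M l w -> ocol y w.
  move=> wl; have [e|//] := point_in_th Oy (oline_point Ol wl) (ly _ wl).
  by case: yl; rewrite -e.
by apply: yl; apply: (otriangle Ol vl ul vu); apply: H.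
Qed.

(** Some point [y] of [l] is not collinear to [w] in the octagon, as there are no triangles. So [s]
    is the symp on [w] and [y], which is [th z] for the point [z] between them. *)
Lemma oline_and_point l w s : OP w -> OL l -> S s -> l =< s -> pts M s w ->
  ~ pts M l w -> exists2 z, pts M l z & s = th z.
Proof.
move=> Ow Ol Ss ls sw wl; have Ll := oline Ol.
have [u ul] := line_point_ex Ll; have [v vl vu] := line_other_point u Ll.
have ne y : pts M l y -> w <> y by move=> yl e; apply: wl; rewrite e.
have [y yl d] : exists2 y, pts M l y & dist w y 2.
  have [cu|d] := common_symp Ow (oline_point Ol ul) (ne _ ul) Ss sw (ls _ ul); last by exists u.
  have [cv|d] := common_symp Ow (oline_point Ol vl) (ne _ vl) Ss sw (ls _ vl); last by exists v.
  by case: wl; apply: (otriangle Ol vl ul vu).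
have [z [_ _ wz zy]] := odist2P d.
have e := dist2_symp d wz zy Ss sw (ls _ yl).
exists z => //; apply: oline_in_th => //; first exact: (ocol_pointl zy).
by rewrite -e.
Qed.

(** The common neighbour excludes opposite points, that is distance 4. *)
Lemma near_cases x w n : OP x -> OP w -> x <> w -> col n x -> col n w ->
  [\/ ocol x w, dist x w 2 | dist x w 3].
Proof.
move=> Ox Ow xw nx nw; have [d [d0 d4 gd]] := odist_ex Ox Ow xw.
case: d d0 d4 gd => [|[|[|[|[|//]]]]] // _ _ gd.
- by constructor 1; case: ((odist1P x w).1 gd).
- by constructor 2.
- by constructor 3.
have [_ _ _ [H _]] := psO Ox Ow xw; case: (H gd); exists n.
have Pn := col_pointl nx.
by split=> //; apply/(collinearE Pn) => //; apply: opoint.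
Qed.

Lemma special_eq x w c c' : OP x -> OP w -> dist x w 3 -> col c x -> col c w ->
  col c' x -> col c' w -> c = c'.
Proof.
move=> Ox Ow d cx cw cx' cw'; have xw : x <> w by case: d => _ /(_ 0 isT).
have [_ _ [H _] _] := psO Ox Ow xw; have [_ [c0 [_ u]]] := H d.
have E k : col k x -> col k w -> c0 = k.
  move=> kx kw; apply: u; have Pk := col_pointl kx.
  by split=> //; apply/(collinearE Pk) => //; apply: opoint.
by rewrite -(E c) // (E c').
Qed.

(** In the plane [q] of [th a] and [th b], the line of neighbours of [x] meets that of [w],
    necessarily in [c]. Were [c] also in [th x], it would be [a] by [th_dist2], but [a] and [w] are
    not collinear. *)
Lemma special_neighbour x a b w c : ocol x a -> ocol a b -> ocol b w ->
  dist x b 2 -> dist a w 2 -> dist x w 3 -> col c x -> col c w ->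
  [/\ pts M (th a) c, pts M (th b) c & ~ pts M (th x) c].
Proof.
move=> xa ab bw dxb daw dxw cx cw.
have Ox := ocol_pointl xa; have Oa := ocol_pointr xa.
have Ob := ocol_pointr ab; have Ow := ocol_pointr bw.
have anb : a <> b by move=> e; apply: (dist2_not_col dxb); rewrite -e; apply: ocol_col.
have [ne [q [Qq qa qb]]] := th_adjacent ab anb.
have off u v : OP v -> dist u v 2 -> ~ pts M (th v) u.
  move=> Ov d uv; have [Ou _] := dist2_points d.
  have [e|c'] := point_in_th Ov Ou uv; first exact: dist2_neq d e.
  by apply: (dist2_not_col d); apply/ocol_col/ocol_sym.
have xq : ~ pts M q x by move=> /qb; apply: off.
have wq : ~ pts M q w by move=> /qa; apply: off => //; apply: odist_sym.
have [n [Ln nq xn]] := symp_perp_plane (th_symp Oa) Qq qa (th_ocol (ocol_sym xa)) xq.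
have [m [Lm mq wm]] := symp_perp_plane (th_symp Ob) Qq qb (th_ocol bw) wq.
have [k kn km] := plane_lines_meet Qq Ln Lm nq mq.
have e : c = k.
  apply: (special_eq Ox Ow dxw) => //; apply: col_sym.
    by apply/xn => //; apply: nq.
  by apply/wm => //; apply: mq.
rewrite -e in kn km; have ca := qa _ (nq _ kn); have cb := qb _ (nq _ kn).
split=> // cth; have ca' := th_dist2 dxb xa ab cth cb.
by apply: (dist2_not_col daw); rewrite -ca'.
Qed.
Lemma oline_other x l : OP x -> exists l', [/\ OL l', pts M l' x & l' <> l].
Proof.
move=> Ox; have [_ _ _ [s [t [_ t2 H _]]]] := octO.
have : `I_2 #<= [set l | OL l /\ incident O x l].
  rewrite (card_le_eqr (H x Ox)); apply: card_le_trans t2 _.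
  apply: card_le_trans (subset_card_le (@subsetT _ (some @` [set: t]))).
  by have := @card_some _ [set: t]; rewrite card_eq_le => /andP[].
move=> /(card_avoid (fun=> l)) [l' [Ol' xl'] ne].
exists l'; split=> //; last exact: (ne 0).
exact/(oincident_line _ Ol').
Qed.

(** * Dense embeddings *)

Section Dense.
Hypothesis dense : dense_embedding O M.

(* Since x and w are not collinear, the symp th z on both contains all their
   common neighbours, hence n0, and then all points of s collinear to x. *)
Lemma dist2_plane s x w z n0 n : S s -> ~ pts M s x -> pts M s w -> pts M s n0 ->
  col x n0 -> col w n0 -> dist x w 2 -> ocol x z -> ocol z w -> L n ->
  (forall y, pts M s y -> (col x y <-> pts M n y)) ->
  exists q, [/\ Q q, n =< q, q =< th z & pts M q w].
Proof.
move=> Ss sx sw sn xn wn d xz zw Ln H.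
have Oz := ocol_pointr xz.
have nxw := dist2_not_col d.
have zx : pts M (th z) x by apply/th_ocol/ocol_sym.
have zw' : pts M (th z) w by apply/th_ocol.
have zn : pts M (th z) n0.
  apply: contrapT => zn; apply: nxw.
  by apply: (perp_symp_clique (th_symp Oz) zn) => //; apply: col_sym.
have wne : w <> n0 by move=> e; apply: nxw; rewrite e.
have [q [Qq nq qz _ qw]] :=
  perp_line_plane Ss (th_symp Oz) sx zx zw' sw zn sn wne nxw Ln H.
by exists q.
Qed.

(** The neighbours of [x] in [s] are the points of [n]. At distance 1, [w] is on [n] and the octagon
    line on [x] and [w] is in [q]. At distance 2, [th z] contains [n] and [x], hence [q], so [z] is
    in [q]. Distance 3 contradicts [special_neighbour], since the common neighbour is on [n], in
    [th x]. *)
Lemma plane_has_oline x q : OP x -> Q q -> pts M q x -> q =< th x ->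
  exists l, [/\ OL l, pts M l x & l =< q].
Proof.
move=> Ox Qq xq qx; have Sx := th_symp Ox.
have [n [[Ln nx] nq xn]] := plane_has_line (symp_polar Sx) (conj Qq qx) (th_self Ox).
have [r [Qr rx rq nr]] := symp_line_other_plane q Sx Ln nx.
have [s [Ss rs sx]] := plane_other_symp (th x) Qr.
have xs : ~ pts M s x.
  move=> xs; have xr := symps_meet_plane Ss Sx sx Qr rs rx xs (th_self Ox).
  apply: rq.
  exact: (plane_uniq (symp_polar Sx) (conj Qr rx) (conj Qq qx) (conj Ln nx)
    nr nq xr xq xn).
have [w Ow sw] := dense Ss.
have ns := subset_trans nr rs.
have [n0 n0n wn0] := symp_proj Ss Ln ns sw.
have xn0 y : pts M n y -> col x y by move=> yn; apply: (plane_col Qq xq (nq _ yn)).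
have xw : x <> w by move=> e; apply: xs; rewrite e.
have [q' [n' [_ Ln' _ [_ _ H]]]] := perp_symp Ss (ns _ n0n) xs (xn0 _ n0n).
have e : n = n'.
  by apply: (line_sub_eq) => // y yn; apply/H; [apply: ns|apply: xn0].
rewrite -{n'}e in Ln' H.
have goal z : pts M q z -> x <> z -> ocol x z -> exists l, [/\ OL l, pts M l x & l =< q].
  move=> zq xz [l Ol [xl zl]]; exists l; split=> //.
  exact: (line_sub_plane Qq (oline Ol) xz xq zq xl zl).
case: (near_cases Ox Ow xw (col_sym (xn0 _ n0n)) (col_sym wn0)).
- move=> c; apply: (goal w) => //; apply/nq/H => //; exact: (ocol_col c).
- move=> d; have [z [zx zw xz czw]] := odist2P d.
  have [q1 [Q1 nq1 qz _]] := dist2_plane Ss xs sw (ns _ n0n) (xn0 _ n0n) wn0 d xz czw Ln H.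
  have Oz := ocol_pointr xz.
  have qthz : q =< th z.
    apply: (plane_sub_symp Qq Ln (th_symp Oz) nq xq xn (subset_trans nq1 qz)).
    exact/th_ocol/ocol_sym.
  have [ne _] := th_adjacent xz (not_eq_sym zx).
  apply: (goal z) => //; last exact: not_eq_sym.
  by apply: (symps_meet_plane Sx (th_symp Oz) ne Qq qx qthz); [apply: th_ocol|apply: th_self].
- move=> d; have [a [b [xa ab bw dxb daw]]] := odist3P d.
  have [_ _ []] := special_neighbour xa ab bw dxb daw d
    (col_sym (xn0 _ n0n)) (col_sym wn0).
  exact/nx.
Qed.

(* Let s' meet s in a plane containing p and missing l, and let w be a point of
   the octagon in s'.  Some u on l is at distance 2 from w, all other points v
   of l are at distance 3, and p is the unique point collinear to v and w. *)
Lemma unique_th_through l s p : OL l -> S s -> l =< s ->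
  (forall z, OP z -> s <> th z) -> pts M s p -> ~ pts M l p ->
  (forall y, pts M l y -> col p y) ->
  exists u, [/\ pts M l u, pts M (th u) p &
    forall v, pts M l v -> v <> u -> ~ pts M (th v) p].
Proof.
move=> Ol Ss ls sth sp pl pcl; have Ll := oline Ol.
have [q [Qq qs lq pq]] := symp_plane_of_line Ss Ll ls sp pl pcl.
have [r [[Qr rs] pr rl]] := plane_missing_line (symp_polar Ss)
  (conj Qq qs) (conj Ll ls) lq pq pl.
have [s' [Ss' rs' s's]] := plane_other_symp s Qr.
have meet := symps_meet_plane Ss' Ss s's Qr rs' rs.
have off v : pts M l v -> ~ pts M s' v.
  by move=> vl vs'; apply: (rl v vl); apply: meet => //; apply: ls.
have [w Ow sw] := dense Ss'.
have ne v : pts M l v -> w <> v by move=> vl e; apply: (off v vl); rewrite -e.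
have perp v : pts M l v -> exists n, [/\ L n, n =< r &
    forall y, pts M s' y -> (col v y <-> pts M n y)].
  move=> vl; have vr : ~ pts M r v by apply: rl.
  have [n [Ln nr Hn]] := symp_perp_plane Ss Qr rs (ls _ vl) vr.
  have [_ [n' [_ Ln' _ [_ ns' Hn']]]] :=
    perp_symp Ss' (rs' _ pr) (off v vl) (col_sym (pcl v vl)).
  have e : n = n'.
    apply: (line_sub_eq) => // y yn; apply/Hn'; first exact/rs'/nr.
    by apply/Hn => //; apply: nr.
  by exists n; split=> // y sy; rewrite e; apply: Hn'.
have far v : pts M l v -> dist w v 2 \/ dist w v 3.
  move=> vl; have [n [Ln nr Hn]] := perp v vl.
  have [n0 n0n wn0] := symp_proj Ss' Ln (subset_trans nr rs') sw.
  have vn0 : col v n0 by apply/Hn => //; apply/rs'/nr.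
  case: (near_cases Ow (oline_point Ol vl) (ne v vl) (col_sym wn0) (col_sym vn0)); auto.
  (* Distance 1 would put [w] on [r], hence in [s], and [s] would polarise a point of [l]. *)
  move=> c; exfalso; have wn : pts M n w by apply/Hn => //; apply/ocol_col/ocol_sym.
  have wl : ~ pts M l w by move=> wl; apply: (ne w wl).
  have [z zl e] := oline_and_point Ow Ol Ss ls (rs _ (nr _ wn)) wl.
  exact: (sth z (oline_point Ol zl)).
have [u [z [ul uz zw H]]] := nearest_point Ow Ol far.
have [v0 v0l v0u] := line_other_point u Ll.
have [_ _ duw] := H v0 v0l v0u.
have [n [Ln nr Hn]] := perp u ul.
have pn : pts M n p by apply/Hn; [apply: rs'|apply/col_sym/pcl].
have [n0 n0n wn0] := symp_proj Ss' Ln (subset_trans nr rs') sw.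
have un0 : col u n0 by apply/Hn => //; apply/rs'/nr.
have [q1 [Q1 nq1 qz wq]] :=
  dist2_plane Ss' (off u ul) sw (rs' _ (nr _ n0n)) un0 wn0 duw uz zw Ln Hn.
have pw : col p w by apply: (plane_col Q1) => //; apply: nq1.
have K v : pts M l v -> v <> u -> pts M (th u) p /\ ~ pts M (th v) p.
  move=> vl vu; have [dvw dvz _] := H v vl vu.
  have vu' : ocol v u by exists l.
  by have [? _ ?] := special_neighbour vu' uz zw dvz duw dvw (pcl v vl) pw.
by exists u; split=> // [|v vl vu]; [case: (K v0)|case: (K v)].
Qed.

(** The plane that theta assigns to [l]. The last clause becomes the fullness of the dual
    octagon. *)
Definition flat (l q : T) : Prop :=
  [/\ Q q, l =< q, forall x, pts M l x -> q =< th x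
    & forall s, S s -> q =< s -> exists2 x, pts M l x & s = th x].

(** A point of [q] off [l] is in both [th x] and [th y], so [unique_th_through] cannot apply to a
    symp on [q]. *)
Lemma flat_partial l x y q : OL l -> pts M l x -> pts M l y -> x <> y ->
  Q q -> l =< q -> q =< th x -> q =< th y ->
  forall s, S s -> q =< s -> exists2 z, pts M l z & s = th z.
Proof.
move=> Ol xl yl xy Qq lq qx qy s Ss qs.
have ls := subset_trans lq qs.
have [[z Oz e]|no] := pselect (exists2 z, OP z & s = th z).
  by exists z => //; apply: oline_in_th => //; rewrite -e.
have sth z : OP z -> s <> th z by move=> Oz e; apply: no; exists z.
have [p pq pl] := plane_point_off Qq (oline Ol).
have pcl z : pts M l z -> col p z by move=> zl; apply: (plane_col Qq pq (lq _ zl)).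
have [u [ul _ H]] := unique_th_through Ol Ss ls sth (qs _ pq) pl pcl.
have [xu|xu] := pselect (x = u); last by case: (H x xl xu); apply: qx.
have yu : y <> u by rewrite -xu; apply: not_eq_sym.
by case: (H y yl yu); apply: qy.
Qed.

(* Were all symps on l of the form th z, a plane of th x on l would meet th w,
   for w on another line of the octagon through x, in a line. *)
Lemma not_all_th l x : OL l -> pts M l x ->
  exists s, [/\ S s, l =< s & forall z, OP z -> s <> th z].
Proof.
move=> Ol xl; have Ox := oline_point Ol xl; have Ll := oline Ol; apply: contrapT => no.
have all s : S s -> l =< s -> exists2 z, pts M l z & s = th z.
  move=> Ss ls; apply: contrapT => ns; apply: no; exists s; split=> // z Oz e.
  by apply: ns; exists z => //; apply: oline_in_th => //; rewrite -e.
have [l2 [Ol2 xl2 ne]] := oline_other l Ox.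
have [w wl2 wx] := line_other_point x (oline Ol2).
have Ow := oline_point Ol2 wl2.
have wl : ~ pts M l w.
  by move=> wl; apply: ne; apply: (line_eq (oline Ol2) Ll wx).
have xw : ocol x w by exists l2.
have only v : pts M l v -> ocol w v -> v = x.
  move=> vl wv; apply: contrapT => vx; apply: wl.
  by apply: (otriangle Ol vl xl vx wv); apply: ocol_sym.
have d2 v : pts M l v -> v <> x -> dist v w 2.
  move=> vl vx; apply: (@odist2_intro v w x) => //; first by exists l.
  by move=> c; apply/vx/(only v vl)/ocol_sym.
have [_ [e [Qe ex ew]]] := th_adjacent xw (not_eq_sym wx).
have thxw := symps_meet_plane (th_symp Ox) (th_symp Ow)
  (fun E => not_eq_sym wx (th_inj Ox Ow E)) Qe ex ew.
have xe : pts M e x by apply: thxw; [apply: th_self|apply/th_ocol/ocol_sym].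
have lx : l =< th x by apply: th_oline.
have lw v : pts M l v -> pts M (th w) v -> v = x.
  move=> vl vw; have [E|c] := point_in_th Ow (oline_point Ol vl) vw; last exact: only.
  by case: wl; rewrite -E.
have [v vl vx] := line_other_point x Ll.
have ve : ~ pts M e v by move=> /ew vw; apply/vx/(lw v vl).
have [j [Lj je Hj]] := symp_perp_plane (th_symp Ox) Qe ex (lx _ vl) ve.
have xj : pts M j x by apply/Hj => //; apply: (line_col Ll).
have [c cj cx] := line_other_point x Lj.
have cl : ~ pts M l c by move=> cl; apply: cx; apply: (lw c cl); apply/ew/je.
have ccl y : pts M l y -> col c y.
  apply: (symp_col_line (th_symp Ox) Ll lx (ex _ (je _ cj)) vl xl vx).
    by apply/col_sym/Hj => //; apply: je.
  exact: (line_col Lj).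
have [r [Qr rx lr cr]] := symp_plane_of_line (th_symp Ox) Ll lx (ex _ (je _ cj)) cl ccl.
have [s [Ss rs sx]] := plane_other_symp (th x) Qr.
have [z zl E] := all s Ss (subset_trans lr rs).
have zx : z <> x by move=> e'; apply: sx; rewrite E e'.
(* [c] is in both [th z] and [th w], and [z], [w] are at distance 2 with [x] between them. *)
apply: cx; apply: (th_dist2 (d2 z zl zx)) => //; first by exists l.
  by rewrite -E; apply: rs.
exact/ew/je.
Qed.

(** Let [q] be the plane of [th x] and [th y], and suppose that [q] is not in [th z]. A symp [s] on
    [l] that polarises no point meets [th z] in a plane [r] on [l]. The symp on [q] and [r] is some
    [th z'] with [z'] other than [z], so the points of [r] off [l] contradict
    [unique_th_through]. *)
Lemma flat_exists l : OL l -> exists q, flat l q.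
Proof.
move=> Ol; have Ll := oline Ol; have [x xl] := line_point_ex Ll.
have [y yl yx] := line_other_point x Ll; have xy := not_eq_sym yx.
have cxy : ocol x y by exists l.
have [ne [q [Qq qx qy]]] := th_adjacent cxy xy.
have lq : l =< q.
  move=> z zl; apply: (symps_meet_plane _ _ ne Qq qx qy).
  - exact/th_symp/(oline_point Ol xl).
  - exact/th_symp/(oline_point Ol yl).
  - exact: (th_oline Ol xl).
  - exact: (th_oline Ol yl).
have full := flat_partial Ol xl yl xy Qq lq qx qy.
exists q; split=> // z zl; apply: contrapT => zq.
have [s [Ss ls sth]] := not_all_th Ol xl.
have Oz := oline_point Ol zl; have lz := th_oline Ol zl.
have [r [Qr lr rs rz _]] := symps_on_line Ss (th_symp Oz) (sth z Oz) Ll ls lz.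
have [t [St rt qt]] := planes_on_line Qr Qq Ll lr lq.
have [z' z'l e] := full t St qt.
have zz' : z <> z' by move=> E; apply: zq; rewrite E -e.
have [p pr pl] := plane_point_off Qr Ll.
have pcl v : pts M l v -> col p v by move=> vl; apply: (plane_col Qr pr (lr _ vl)).
have [u [ul _ H]] := unique_th_through Ol Ss ls sth (rs _ pr) pl pcl.
have [E|zu] := pselect (z = u); last by case: (H z zl zu); apply: rz.
have z'u : z' <> u by rewrite -E; apply: not_eq_sym.
by case: (H z' z'l z'u); rewrite -e; apply: rt.
Qed.

(** Suppose [p] is not [a]. Then [p] is not in [th b], but it is collinear to [a], because both are
    neighbours in [th x] of the outside point [c]. So the neighbours of [p] in [th b] form a line
    [m] on [a]. A point of [m] collinear to [w] is in [s], as [p] and [w] are not collinear. Hence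
    [s] and [th b] share a plane on [w]; it contains [m], and [a] and [w] would be collinear. *)
Lemma dist3_gate x a b w s p : OP x -> ocol x a -> ocol a b -> ocol b w ->
  dist x b 2 -> dist a w 2 -> dist x w 3 -> S s -> pts M s w -> pts M s p ->
  ~ pts M s x -> pts M (th x) p -> col x p -> p = a.
Proof.
move=> Ox xa ab bw dxb daw dxw Ss sw sp sx px xp.
have Oa := ocol_pointr xa; have Ob := ocol_pointr ab.
have Ow := ocol_pointr bw.
have [_ [n [_ Ln _ [_ ns Hn]]]] := perp_symp Ss sp sx xp.
have [c cn wc] := symp_proj Ss Ln ns sw.
have xc : col x c by apply/Hn => //; apply: ns.
have uc := special_eq Ox Ow dxw (col_sym xc) (col_sym wc).
have [ca cb cx] :=
  special_neighbour xa ab bw dxb daw dxw (col_sym xc) (col_sym wc).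
have bp : pts M (th b) p -> p = a by apply: (th_dist2 dxb xa ab).
have pw : ~ col p w by move=> pw; apply: cx; rewrite (uc p) //; apply: col_sym.
have ba : pts M (th b) a by apply/th_ocol/ocol_sym.
have bw' : pts M (th b) w by apply: th_ocol.
apply: contrapT => pa; have nbp : ~ pts M (th b) p by move/bp.
have [cpa|npa] := pselect (col p a); last first.
  apply: npa; apply: (perp_symp_clique (th_symp Ox) cx px (th_ocol xa)).
    by apply: (line_col Ln) => //; apply/Hn.
  have anb : a <> b by move=> e; apply: (dist2_not_col dxb); rewrite -e; apply: ocol_col.
  have [ne [q [Qq qa qb]]] := th_adjacent ab anb.
  have meet := symps_meet_plane (th_symp Oa) (th_symp Ob) ne Qq qa qb.
  by apply: (plane_col Qq); apply: meet => //; apply: th_self.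
have [_ [m [_ Lm _ [_ mb Hm]]]] := perp_symp (th_symp Ob) ba nbp cpa.
have [h hm wh] := symp_proj (th_symp Ob) Lm mb bw'.
have ph : col p h by apply/Hm => //; apply: mb.
have sh : pts M s h.
  apply: contrapT => sh; apply: pw.
  by apply: (perp_symp_clique Ss sh) => //; apply: col_sym.
have wh' : w <> h by move=> e; apply: pw; rewrite e.
have sb : s <> th b by move=> e; apply: nbp; rewrite -e.
have [l [Ll [wl hl] ls lb]] :=
  symps_meet_line Ss (th_symp Ob) sb wh' sw bw' sh (mb _ hm).
have [q [Qq lq qs qb _]] := symps_on_line Ss (th_symp Ob) sb Ll ls lb.
have pq : ~ pts M q p by move=> /qb.
have [j [Lj jq Hj]] := symp_perp_plane Ss Qq qs sp pq.
have e : j = m.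
  apply: (line_sub_eq) => // y yj; apply/Hm; first exact/qb/jq.
  by apply/Hj => //; apply: jq.
apply: (dist2_not_col daw); apply: (plane_col Qq); last exact: lq.
by apply: jq; rewrite e; apply/Hm.
Qed.

(** The symp [s] meets [th x] only in [p]. At distance 1, [w] is [p]; at distance 3, [p] is the
    first point of the geodesic by [dist3_gate]; in both cases [k] is an octagon line. At distance
    2, [k] is in [th x] and [th z], which meet in the plane of the octagon line on [x] and [z]. *)
Lemma line_in_flat x k : OP x -> L k -> pts M k x -> k =< th x ->
  exists l, [/\ OL l, pts M l x & forall q, flat l q -> k =< q].
Proof.
move=> Ox Lk xk kx; have [p pk px] := line_other_point x Lk.
have xp : x <> p := not_eq_sym px.
have goal : ocol x p -> exists l, [/\ OL l, pts M l x & forall q, flat l q -> k =< q].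
  move=> [l Ol [xl pl]]; exists l; split=> // q [_ lq _ _].
  by rewrite (line_eq Lk (oline Ol) xp).
have [s [Ss sp only]] := symp_meeting_in_point (th_symp Ox) (kx _ pk).
have sx : ~ pts M s x by move=> sx; apply: xp; apply: only => //; apply: th_self.
have cxp : col x p by apply: (line_col Lk).
have [_ [n [_ Ln _ [_ ns Hn]]]] := perp_symp Ss sp sx cxp.
have pn : pts M n p by apply/Hn.
have [w Ow sw] := dense Ss.
have [n0 n0n wn0] := symp_proj Ss Ln ns sw.
have xn0 : col x n0 by apply/Hn => //; apply: ns.
have xw : x <> w by move=> e; apply: sx; rewrite e.
case: (near_cases Ox Ow xw (col_sym xn0) (col_sym wn0)) => [c|d|d].
- by apply: goal; rewrite -(only w) //; apply: th_ocol.
- have [z [zx zw xz czw]] := odist2P d.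
  have [q1 [_ nq1 qz _]] := dist2_plane Ss sx sw (ns _ n0n) xn0 wn0 d xz czw Ln Hn.
  have Oz := ocol_pointr xz.
  have zx' : pts M (th z) x by apply/th_ocol/ocol_sym.
  have kz : k =< th z.
    exact: (line_sub_symp Lk (th_symp Oz) xp xk pk zx' (qz _ (nq1 _ pn))).
  have [ne _] := th_adjacent xz (not_eq_sym zx).
  have [l Ol [xl zl]] := xz; exists l; split=> // q [Qq _ H _] y yk.
  by apply: (symps_meet_plane (th_symp Ox) (th_symp Oz) ne Qq); auto.
- have [a [b [xa ab bw dxb daw]]] := odist3P d.
  apply: goal; rewrite (dist3_gate Ox xa ab bw dxb daw d Ss sw sp sx (kx _ pk) cxp) //.
Qed.
End Dense.

(** * Ovoidal embeddings *)

Section Ovoidal.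
Hypotheses
  (planeth : forall l, OL l -> Q (th l))
  (subth : forall l x, OL l -> pts M l x -> th l =< th x)
  (fullth : forall l s, OL l -> S s -> th l =< s -> exists2 y, OP y & s = th y)
  (ovoid_plane : forall x q, OP x -> Q q -> pts M q x -> q =< th x ->
     exists l, [/\ OL l, pts M l x & l =< q])
  (ovoid_line : forall x k, OP x -> L k -> pts M k x -> k =< th x ->
     exists2 l, OL l & k =< th l).

Definition meets (s : T) : Prop := exists2 w, OP w & pts M s w.

Lemma oline_sub_th l : OL l -> l =< th l.
Proof.
move=> Ol; have Ll := oline Ol; have [x xl] := line_point_ex Ll.
have [y yl yx] := line_other_point x Ll; have xy := not_eq_sym yx.
have cxy : ocol x y by exists l.
have [ne _] := th_adjacent cxy xy.
move=> z zl; apply: (symps_meet_plane _ _ ne (planeth Ol)).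
- exact/th_symp/(oline_point Ol xl).
- exact/th_symp/(oline_point Ol yl).
- exact: subth.
- exact: subth.
- exact: (th_oline Ol xl).
- exact: (th_oline Ol yl).
Qed.

Lemma symp_on_th l s : OL l -> S s -> th l =< s -> exists2 y, pts M l y & s = th y.
Proof.
move=> Ol Ss ls; have [y Oy e] := fullth Ol Ss ls.
exists y => //; apply: oline_in_th => //; rewrite -e.
exact: subset_trans (oline_sub_th Ol) ls.
Qed.

(** If [y] is not in [q], its neighbours in [q] form a line [n], and an octagon line in the plane
    spanned by [y] and [n] meets [n]. *)
Lemma meets_adjacent_th y s q : OP y -> S s -> Q q -> q =< s -> q =< th y -> meets s.
Proof.
move=> Oy Ss Qq qs qy; have [yq|yq] := pselect (pts M q y).
  by exists y => //; apply: qs.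
have [n [Ln nq Hn]] := symp_perp_plane (th_symp Oy) Qq qy (th_self Oy) yq.
have [r [Qr ry nr yr]] := symp_plane_of_line (th_symp Oy) Ln
  (subset_trans nq qy) (th_self Oy) (fun yn => yq (nq _ yn))
  (fun z zn => (Hn z (nq _ zn)).2 zn).
have [l [Ol yl lr]] := ovoid_plane Oy Qr yr ry.
have [w wl wn] := plane_lines_meet Qr (oline Ol) Ln lr nr.
by exists w; [apply: (oline_point Ol wl)|apply/qs/nq].
Qed.

(** By projection in the residue of [p], a symp on the plane [th l] shares a plane with [s]; it is
    [th y] for some [y] on [l]. *)
Lemma meets_through_th l p s : OL l -> pts M (th l) p -> S s -> pts M s p -> meets s.
Proof.
move=> Ol lp Ss sp.
have [t [r [St lt Qr _ [rs rt]]]] := residue_proj Ss sp (planeth Ol) lp.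
have [y yl e] := symp_on_th Ol St lt.
by apply: (meets_adjacent_th (oline_point Ol yl) Ss Qr rs); rewrite -e.
Qed.

(** The plane of [p] and [l] is in a common symp with the plane [th l], and that symp is [th y] with
    [y] on [l]. The line from [y] to [p] is then in the image of an octagon line. *)
Lemma meets_through_perp l p t s : OL l -> S t -> l =< t -> pts M t p ->
  (forall y, pts M l y -> col p y) -> S s -> pts M s p -> meets s.
Proof.
move=> Ol St lt tp pcl Ss sp; have [pl|pl] := pselect (pts M l p).
  by exists p => //; apply: (oline_point Ol pl).
have Ll := oline Ol.
have [r [Qr rt lr pr]] := symp_plane_of_line St Ll lt tp pl pcl.
have [t' [St' rt' lt']] := planes_on_line Qr (planeth Ol) Ll lr (oline_sub_th Ol).
have [y yl e] := symp_on_th Ol St' lt'; have Oy := oline_point Ol yl.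
have yp : pts M (th y) p by rewrite -e; apply: rt'.
have [k [Lk ky yk pk]] :=
  symp_line_between (th_symp Oy) (th_self Oy) yp (col_sym (pcl y yl)).
have [l' Ol' kl'] := ovoid_line Oy Lk yk ky.
exact: (meets_through_th Ol' (kl' _ pk)).
Qed.

(* A plane on x in s is adjacent, within some symp on it, to a plane of th x
   on x; a line l of the octagon in the latter has a common perpendicular line
   with s in the former. *)
Lemma meets_adjacent x s s' q : OP x -> S s -> pts M s x -> S s' -> Q q ->
  q =< s -> q =< s' -> meets s'.
Proof.
move=> Ox Ss sx Ss' Qq qs qs'; have [xq|xq] := pselect (pts M q x).
  by exists x => //; apply: qs'.
have [n [Ln nq Hn]] := symp_perp_plane Ss Qq qs sx xq.
have [r [Qr rs nr xr]] := symp_plane_of_line Ss Ln (subset_trans nq qs) sx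
  (fun xn => xq (nq _ xn)) (fun z zn => (Hn z (nq _ zn)).2 zn).
have [t [r' [St rt Qr' xr' [rx' rt']]]] := residue_proj (th_symp Ox) (th_self Ox) Qr xr.
have [l [Ol xl lr']] := ovoid_plane Ox Qr' xr' rx'.
have lt := subset_trans lr' rt'; have Ll := oline Ol.
have done_at w : pts M l w -> pts M n w -> meets s'.
  by move=> wl wn; exists w; [apply: (oline_point Ol wl)|apply/qs'/nq].
have [lr|lr] := pselect (l =< r).
  by have [w wl wn] := plane_lines_meet Qr Ll Ln lr nr; apply: (done_at w).
have [v vl vr] : exists2 v, pts M l v & ~ pts M r v.
  by apply: contrapT => H; apply: lr => v vl; apply: contrapT => vr; apply: H; exists v.
(* The neighbours of [v] in [r] form [m]. Where [m] meets [n], [p] is collinear to [v] and to [x],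
   hence to all of [l]. *)
have [m [Lm mr Hm]] := symp_perp_plane St Qr rt (lt _ vl) vr.
have [p pm pn] := plane_lines_meet Qr Lm Ln mr nr.
have vx : v <> x by move=> e; apply: vr; rewrite e.
have tp : pts M t p by apply/rt/mr.
apply: (meets_through_perp Ol St lt tp _ Ss'); last exact/qs'/nq.
move=> y; apply: (symp_col_line St Ll lt tp vl xl vx).
  by apply/col_sym/Hm => //; apply: mr.
by apply: (plane_col Qr) => //; apply: mr.
Qed.

(** Projection in the residue of [p] gives a symp [t] sharing a plane with [s] and one with [s']. *)
Lemma meets_intersecting s s' p : S s -> meets s -> pts M s p -> S s' ->
  pts M s' p -> meets s'.
Proof.
move=> Ss [x Ox sx] sp Ss' sp'.
have [q [Qq pq qs']] := symp_plane_at Ss' sp'.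
have [t [r [St qt Qr _ [rs rt]]]] := residue_proj Ss sp Qq pq.
have [y Oy ty] := meets_adjacent Ox Ss sx St Qr rs rt.
exact: (meets_adjacent Oy St ty Ss' Qq qt qs').
Qed.

Lemma ovoidal_dense : dense_embedding O M.
Proof.
have [[neO _ _] _ _ _] := octO; have [x Ox] := neO (@Ordinal 2 0 isT).
(* Connectedness walks through elements of all types, so the property is extended from symps to all
   of them. Two symps met in one step share the point of a chamber. *)
pose good u := exists s, [/\ S s, u =< s & meets s].
have step u v : incident M u v -> good u -> good v.
  move=> [c [i [j [Cc _ <- <-]]]] [s [Ss us ms]].
  have [[P0 L1 Q2 S3] [c01 c12 c23]] := chamberP Cc.
  have in0 : forall k, pts M (c k) (c (@Ordinal 4 0 isT)).
    apply: ord4P => //; last 2 first.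
    - exact: c12.
    - exact/c23/c12.
    by rewrite point_pts.
  have sub3 : forall k, c k =< c (@Ordinal 4 3 isT).
    apply: ord4P => //; last exact: subset_trans c12 c23.
    by rewrite point_pts // => _ ->; apply: in0.
  exists (c (@Ordinal 4 3 isT)); split=> //.
  by apply: (meets_intersecting Ss ms (us _ (in0 i)) S3); apply: in0.
have walk_good k u v : walk (incident M) k u v -> good u -> good v.
  elim: k u => [u /= -> //|k IH u [w uw wv] gu].
  exact: (IH w wv (step _ _ uw gu)).
move=> s Ss; have [k w] := ms_connected msM
  (ex_intro _ (@Ordinal 4 3 isT) (th_symp Ox)) (ex_intro _ (@Ordinal 4 3 isT) Ss).
have [|t [St st mt]] := walk_good _ _ _ w.
  by exists (th x); split=> //; [apply: th_symp|exists x => //; apply: th_self].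
have [l [Ll ls]] : exists l, L l /\ l =< s.
  have [c Cc <-] := @in_chamber (@Ordinal 4 3 isT) s Ss.
  have [[_ ? _ _] [_ ? ?]] := chamberP Cc; exists (c (@Ordinal 4 1 isT)).
  by split=> //; apply: (subset_trans (B:=pts M (c (@Ordinal 4 2 isT)))).
have [p pl] := line_point_ex Ll.
exact: (meets_intersecting St mt (st _ (ls _ pl)) Ss (ls _ pl)).
Qed.
End Ovoidal.

(** * The dual octagon and the quadrangles at its points *)

Lemma dual_points s : points (dual_geometry M) s <-> S s.
Proof.
rewrite /points /= (_ : rev_ord _ = @Ordinal 4 3 isT) //; exact/val_inj.
Qed.

Lemma dual_lines q : lines (dual_geometry M) q <-> Q q.
Proof.
rewrite /lines /= (_ : rev_ord _ = @Ordinal 4 2 isT) //; exact/val_inj.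
Qed.

Lemma plane_symp_incident q s : Q q -> S s -> (incident M q s <-> q =< s).
Proof. exact: (@incidentE (@Ordinal 4 2 isT) (@Ordinal 4 3 isT)). Qed.

Lemma dual_plane_pts q s : Q q -> (pts (dual_geometry M) q s <-> S s /\ q =< s).
Proof.
move=> Qq; split=> [[/dual_points Ss [e|/dual_incident inc]]|[Ss qs]].
- have Qq' : Q s by rewrite e.
  by have := geometry_disjoint (ms_geometry msM) Qq' Ss.
- by split=> //; apply/(plane_symp_incident Qq Ss)/incident_sym.
split; first exact/dual_points.
by right; apply/dual_incident/incident_sym/plane_symp_incident.
Qed.

Lemma oline_through x : OP x -> exists2 l, OL l & pts M l x.
Proof. by move=> /(oline_other x) [l [Ol xl _]]; exists l. Qed.

Lemma point_incident x u k : points M x -> element M k u -> (0 < k)%N ->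
  (incident M x u <-> pts M u x).
Proof.
move=> Px ku k0; rewrite (@incidentE (@Ordinal 4 0 isT) k _ _ k0 Px ku).
exact: point_subE.
Qed.

Lemma line_symp_incident l s : L l -> S s -> (incident M l s <-> l =< s).
Proof. exact: (@incidentE (@Ordinal 4 1 isT) (@Ordinal 4 3 isT)). Qed.

Lemma line_plane_incident l q : L l -> Q q -> (incident M l q <-> l =< q).
Proof. exact: (@incidentE (@Ordinal 4 1 isT) (@Ordinal 4 2 isT)). Qed.

Lemma gq_point x l : OP x -> points (symp_gq M x (th x)) l <->
  [/\ L l, pts M l x & l =< th x].
Proof.
move=> Ox; have Px := opoint Ox; have Ss := th_symp Ox.
split=> -[Ll xl ls]; split=> //; do ?exact/(@point_incident x l (@Ordinal 4 1 isT)).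
  exact/(line_symp_incident Ll Ss).
exact/(line_symp_incident Ll Ss).
Qed.

Lemma gq_line x q : OP x -> lines (symp_gq M x (th x)) q <->
  [/\ Q q, pts M q x & q =< th x].
Proof.
move=> Ox; have Px := opoint Ox; have Ss := th_symp Ox.
split=> -[Qq xq qs]; split=> //; do ?exact/(@point_incident x q (@Ordinal 4 2 isT)).
  exact/(plane_symp_incident Qq Ss).
exact/(plane_symp_incident Qq Ss).
Qed.

Lemma gq_incident x l q : OP x -> points (symp_gq M x (th x)) l ->
  lines (symp_gq M x (th x)) q ->
  (incident (symp_gq M x (th x)) l q <-> l =< q).
Proof.
move=> Ox Gl Gq; have [Ll _ _] := (gq_point l Ox).1 Gl.
have [Qq _ _] := (gq_line q Ox).1 Gq.
split=> [inc|lq].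
  exact/(line_plane_incident Ll Qq)/(subgeometry2_incident inc).
by apply: incident_subgeometry2 => //; apply/line_plane_incident.
Qed.

(** If [v] and [v'] were collinear in the octagon, they would form a triangle with [x]. This gives
    uniqueness in both ovoid conditions. *)
Lemma octagon_lines_dist2 x l l' v v' : OL l -> OL l' -> pts M l x -> pts M l' x ->
  l <> l' -> pts M l v -> pts M l' v' -> v <> x -> v' <> x -> dist v v' 2.
Proof.
move=> Ol Ol' xl xl' ne vl vl' vx vx'.
have cvx : ocol v x by exists l.
have cxv : ocol x v' by exists l'.
apply: (odist2_intro cvx cxv) => c; apply: ne.
apply: (line_eq (oline Ol) (oline Ol') vx' _ xl vl' xl').
by apply: (otriangle Ol vl xl vx); apply: ocol_sym.
Qed.

Section Forward.
Hypotheses (symth : symmetric_via O M th)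
  (ovth : forall x, OP x -> let G := symp_gq M x (th x) in
     ovoid G (OL `&` points G) /\ ovoid (dual_geometry G) (lines Obar `&` lines G)).

Lemma symmetric_ovoidal_dense : dense_embedding O M.
Proof.
have [_ B _ [_ _ _ full]] := symth.
apply: ovoidal_dense => //.
- by move=> l /B [].
- move=> l x Ol xl; have [_ H] := B l Ol; apply: H; first exact: (oline_point Ol xl).
  exact/(oincident_line _ Ol).
- move=> l s Ol Ss ls; have [Ql _] := B l Ol.
  have Ll : lines Obar (th l) by exists l.
  have [y Oy <-] := full _ Ll s ((dual_plane_pts s Ql).2 (conj Ss ls)).
  by exists y.
- move=> x q Ox Qq xq qx; have [[_ H] _] := ovth Ox.
  have Gq : lines (symp_gq M x (th x)) q by apply/gq_line.
  have [l [[[Ol Gl] lq] _]] := H q Gq; have [_ xl _] := (gq_point l Ox).1 Gl.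
  by exists l; split=> //; apply/(gq_incident Ox Gl Gq).
- move=> x k Ox Lk xk kx; have [_ [_ H]] := ovth Ox.
  have Gk : points (symp_gq M x (th x)) k by apply/gq_point.
  have [q [[[[l Ol <-] Gq] inc] _]] := H k Gk; exists l => //.
  by apply/(gq_incident Ox Gk Gq)/incident_sym/dual_incident.
Qed.
End Forward.

(** * From dense to symmetric and ovoidal *)

Section Backward.
Hypothesis dense : dense_embedding O M.
Hypothesis flatth : forall l, OL l -> flat l (th l).

Lemma th_incidence x l : OP x -> OL l -> (pts M l x <-> th l =< th x).
Proof.
move=> Ox Ol; have [_ _ sub full] := flatth Ol; split=> [|lx]; first exact: sub.
have [y yl e] := full _ (th_symp Ox) lx.
by rewrite (th_inj Ox (oline_point Ol yl) e).
Qed.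

Lemma th_line_inj l l' : OL l -> OL l' -> th l = th l' -> l = l'.
Proof.
move=> Ol Ol' e; apply: (line_sub_eq (oline Ol) (oline Ol')) => x xl.
have Ox := oline_point Ol xl; apply/(th_incidence Ox Ol'); rewrite -e.
exact/th_incidence.
Qed.

Lemma dual_octagon_geometry : is_geometry Obar.
Proof.
have [[neO _ _] _ _ _] := octO.
have ordP (k : 'I_2) : k = ord0 \/ k = ord_max.
  by case: k => -[|[|//]] ltk; [left|right]; apply/val_inj.
have disj s : (th @` OP) s -> (th @` OL) s -> False.
  move=> [x Ox <-] [l Ol e]; have [Ql _ _ _] := flatth Ol.
  by rewrite e in Ql; have := geometry_disjoint (ms_geometry msM) Ql (th_symp Ox).
split.
- move=> i; case: (ordP i) => ->.
    by have [x Ox] := neO (@Ordinal 2 0 isT); exists (th x); exists x.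
  by have [l Ol] := neO (@Ordinal 2 1 isT); exists (th l); exists l.
- move=> i j _ _; case: (ordP i) (ordP j) => -> [] -> [s [si sj]] //.
    by case: (disj s).
  by case: (disj s).
- by move=> c [c0 c1 _] i; case: (ordP i) => ->.
Qed.

Lemma dual_octagon_incident x l : OP x -> OL l ->
  (incident O x l <-> incident Obar (th x) (th l)).
Proof.
move=> Ox Ol; have [Ql _ _ _] := flatth Ol; have Ss := th_symp Ox.
have E : pts M l x <-> incident (dual_geometry M) (th x) (th l).
  rewrite dual_incident (th_incidence Ox Ol) -(plane_symp_incident Ql Ss).
  by split; apply: incident_sym.
rewrite (oincident_line _ Ol) E; split=> inc; last exact: subgeometry2_incident inc.
exact: incident_subgeometry2.
Qed.

Lemma dual_octagon_octagon : generalised_octagon Obar.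
Proof.
have gOb := dual_octagon_geometry.
have disjP x l : OP x -> OL l -> th x <> th l.
  move=> Ox Ol e; have [Ql _ _ _] := flatth Ol; rewrite -e in Ql.
  by have := geometry_disjoint (ms_geometry msM) Ql (th_symp Ox).
have no_inc (G : geometry T 2) k u v : is_geometry G -> element G k u ->
    element G k v -> ~ incident G u v.
  move=> [ne tr ch] ku kv [c [i [j [Cc ij ci cj]]]].
  have ei := ch _ Cc i; have ej := ch _ Cc j; rewrite ci in ei; rewrite cj in ej.
  move/negP: ij; case; apply/eqP.
  by rewrite (geometry_disjoint (And3 ne tr ch) ei ku) (geometry_disjoint (And3 ne tr ch) ej kv).
apply: (@octagon_image T O Obar th gOb) => //.
  move=> u v /elements2E [Ou|Ou] /elements2E [Ov|Ov] e.
  - exact: th_inj.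
  - by case: (disjP u v Ou Ov).
  - by case: (disjP v u Ov Ou).
  - exact: th_line_inj.
move=> u v /elements2E [Ou|Ou] /elements2E [Ov|Ov].
- split=> [inc|]; first by case: (no_inc O _ u v gO Ou Ov).
  move=> inc; case: (no_inc Obar (@Ordinal 2 0 isT) (th u) (th v)) => //; by [exists u|exists v].
- exact: dual_octagon_incident.
- have [to from] := dual_octagon_incident Ov Ou.
  by split=> inc; apply: incident_sym; [apply: to|apply: from]; apply: incident_sym.
- split=> [inc|]; first by case: (no_inc O _ u v gO Ou Ov).
  move=> inc; case: (no_inc Obar (@Ordinal 2 1 isT) (th u) (th v)) => //; by [exists u|exists v].
Qed.

Lemma dense_symmetric : symmetric_via O M th.
Proof.
split.
- move=> x Ox; split; first exact: th_symp.
  by move=> y Oy /odist1P [_]; apply: th_ocol.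
- move=> l Ol; have [Ql _ sub _] := flatth Ol; split=> // x Ox.
  by move=> /(oincident_line _ Ol); apply: sub.
- exact: dual_octagon_octagon.
split.
- by move=> _ [x Ox <-]; apply/dual_points/th_symp.
- by move=> _ [l Ol <-]; apply/dual_lines; case: (flatth Ol).
- move=> _ _ [x Ox <-] [l Ol <-]; split=> inc; first exact: subgeometry2_incident inc.
  exact: incident_subgeometry2.
- move=> _ [l Ol <-] s; have [Ql _ _ full] := flatth Ol.
  move=> /(dual_plane_pts s Ql) [Ss ls]; have [x xl ->] := full s Ss ls.
  by exists x => //; apply: (oline_point Ol xl).
Qed.

Lemma dense_ovoidal x : OP x -> let G := symp_gq M x (th x) in
  ovoid G (OL `&` points G) /\ ovoid (dual_geometry G) (lines Obar `&` lines G).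
Proof.
move=> Ox G; split; (split; first by move=> u [_ Gu]).
- move=> q Gq; have [Qq xq qx] := (gq_line q Ox).1 Gq.
  have [l [Ol xl lq]] := plane_has_oline dense Ox Qq xq qx.
  have gq l' : OL l' -> pts M l' x -> points G l'.
    by move=> Ol' xl'; apply/(gq_point l' Ox); split=> //; [exact: oline|exact: (th_oline Ol' xl')].
  exists l; split.
    by split; [split=> //; apply: gq|apply/(gq_incident Ox (gq l Ol xl) Gq)].
  move=> l' [[Ol' Gl'] inc]; have [_ xl' _] := (gq_point l' Ox).1 Gl'.
  have lq' := (gq_incident Ox Gl' Gq).1 inc.
  (* Two octagon lines in [q] would have collinear points at distance 2. *)
  apply: contrapT => ne; have [v vl vx] := line_other_point x (oline Ol).
  have [v' vl' vx'] := line_other_point x (oline Ol').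
  apply: (dist2_not_col (octagon_lines_dist2 Ol Ol' xl xl' ne vl vl' vx vx')).
  by apply: (plane_col Qq); auto.
- move=> k Gk; have [Lk xk kx] := (gq_point k Ox).1 Gk.
  have [l [Ol xl H]] := line_in_flat dense Ox Lk xk kx.
  have kl := H _ (flatth Ol).
  have inc q : lines G q -> (incident (dual_geometry G) q k <-> k =< q).
    move=> Gq; rewrite dual_incident -(gq_incident Ox Gk Gq).
    by split; apply: incident_sym.
  have Gl : lines G (th l).
    apply/(gq_line _ Ox); have [Ql _ sub _] := flatth Ol.
    by split=> //; [apply: kl|apply: sub].
  exists (th l); split; first by split; [split=> //; exists l|apply/inc].
  move=> _ [[[l' Ol' <-] Gl'] /(inc _ Gl') kl']; congr th.
  have [_ _ lx'] := (gq_line _ Ox).1 Gl'.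
  have xl' := (th_incidence Ox Ol').2 lx'.
  (* Otherwise [k] is in [th v] and in [th v'], which share only [x]. *)
  apply: contrapT => ne; have [v vl vx] := line_other_point x (oline Ol).
  have [v' vl' vx'] := line_other_point x (oline Ol').
  have d := octagon_lines_dist2 Ol Ol' xl xl' ne vl vl' vx vx'.
  have [y yk yx] := line_other_point x Lk; apply: yx.
  have [_ _ sub _] := flatth Ol; have [_ _ sub' _] := flatth Ol'.
  apply: (th_dist2 d) => //; [by exists l|by exists l'| |].
    exact/(sub v vl)/kl.
  exact/(sub' v' vl')/kl'.
Qed.
End Backward.
End Polarised.
End Octagon.
End Metasymplectic.

Theorem theorem5p4 (T : Type) (M : geometry T 4) (O : geometry T 2) :
  metasymplectic_space M -> generalised_octagon O -> fully_embedded O M ->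
  pseudo_isometric O M -> strongly_polarised O M ->
  (symmetric_embedding O M /\ ovoidal_embedding O M) <-> dense_embedding O M.
Proof.
move=> msM octO embO psO spO; split=> [[_ [th [symth ovth]]]|dense].
  apply: (symmetric_ovoidal_dense msM octO embO psO spO _ symth ovth) => x Ox.
  have [A _ _ _] := symth; have [Sx H] := A x Ox.
  have [l Ol xl] := oline_through msM octO embO Ox.
  have Ll := oline embO Ol.
  (* Symmetry speaks only of points at distance 1 from [x]. That [x] itself is in [th x] follows
     from two other points of an octagon line through it. *)
  have in1 y : pts M l y -> y <> x -> pts M (th x) y.
    move=> yl yx; apply: H; first exact: (oline_point embO Ol yl).
    by apply/(odist1P msM octO embO); split; [exact: not_eq_sym|exists l].
  have [y yl yx] := line_other_point msM x Ll.
  have [z [zl zx zy]] := line_third_point msM x y Ll.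
  split=> //.
    by apply: (line_sub_symp msM Ll Sx zy zl yl); auto.
  move=> w Ow /(ocollinearE msM octO embO) xw.
  have [->|wx] := pselect (w = x).
    by apply: (line_sub_symp msM Ll Sx zy zl yl); auto.
  by apply: H => //; apply/(odist1P msM octO embO); split; [exact: not_eq_sym|].
have [th0 th0P] : {th0 : T -> T &
    forall x, points O x -> polarising_symp O M x (th0 x)}.
  apply: (@choice T T (fun x s => points O x -> polarising_symp O M x s)) => x.
  have [Ox|nOx] := pselect (points O x); last by exists x.
  by have [s [ps _]] := spO.1 x Ox; exists s.
have [fl flP] : {fl : T -> T & forall l, lines O l -> flat M th0 l (fl l)}.
  apply: (@choice T T (fun l q => lines O l -> flat M th0 l q)) => l.
  have [Ol|nOl] := pselect (lines O l); last by exists l.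
  by have [q] := flat_exists msM octO embO psO spO th0P dense Ol; exists q.
(* Theta is one map on the ambient type: symps at the points, flats at the lines of the octagon. *)
pose th x := if pselect (points O x) then th0 x else fl x.
have thP x : points O x -> th x = th0 x by rewrite /th; case: pselect.
have gO : is_geometry O by case: octO.
have thL l : lines O l -> th l = fl l.
  rewrite /th; case: pselect => // Ol Ol'.
  by have := geometry_disjoint gO Ol Ol'.
have polth x : points O x -> polarising_symp O M x (th x).
  by move=> Ox; rewrite thP //; apply: th0P.
have flatth l : lines O l -> flat M th l (th l).
  move=> Ol; rewrite thL //; have [Ql lq sub full] := flP l Ol.
  split=> // [x xl|s Ss ls]; first by rewrite (thP x (oline_point embO Ol xl)); apply: sub.
  have [x xl ->] := full s Ss ls; exists x => //.
  by rewrite thP //; apply: (oline_point embO Ol xl).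
have symth : symmetric_via O M th by apply: dense_symmetric.
split; exists th => //; split=> // x Ox.
exact: dense_ovoidal.
Qed.
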